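(* (1) Let $\Phi:H_n\to H_k$ be a unital trace-preserving linear map satisfying $\gamma(\Phi)=\|\Phi\|_{1\to2}^2$, and let $\Omega:H_m\to H_l$ be a completely positive linear map. Then \[ \|\Phi\otimes\Omega\|_{1\to2}=\|\Phi\|_{1\to2}\,\|\Omega\|_{1\to2}, \] and, if moreover $\Phi$ and $\Omega$ are quantum channels, $S_{\min,2}(\Phi\otimes\Omega)=S_{\min,2}(\Phi)+S_{\min,2}(\Omega)$. (2) For unital quantum channels $\Phi_i:H_{n_i}\to H_{k_i}$, $i=1,\dots,N$, each satisfying $\gamma(\Phi_i)=\|\Phi_i\|_{1\to2}^2$, \[ \left\|\bigotimes_{i=1}^N\Phi_i\right\|_{1\to2}=\prod_{i=1}^N\|\Phi_i\|_{1\to2}\qquad\text{and}\qquad S_{\min,2}\left(\bigotimes_{i=1}^N\Phi_i\right)=\sum_{i=1}^N S_{\min,2}(\Phi_i). \]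
   Context: $H_n$ is the real vector space of $n\times n$ Hermitian matrices with inner product ${\rm Tr}(XY)$, $H_{n,0}$ its traceless subspace, $H_{n,+,1}$ the density matrices. A quantum channel is a completely positive trace-preserving map; $\Phi:H_n\to H_k$ is unital if $\Phi(I_n/n)=I_k/k$. $\|\Phi\|_{1\to2}=\max_{0\neq\rho}\|\Phi(\rho)\|_2/\|\rho\|_1$ over nonzero Hermitian $\rho$. $S_2(\sigma)=-\log{\rm Tr}\,\sigma^2$ and $S_{\min,2}(\Phi)=\min_{\rho\in H_{n,+,1}}S_2(\Phi(\rho))$. For a unital trace-preserving $\Phi:H_n\to H_k$, fix an orthonormal basis $M_1,\dots,M_{n^2-1}$ of $H_{n,0}$, let $(A_\Phi)_{i,j}={\rm Tr}[\Phi(M_i)\Phi(M_j)]$ with largest eigenvalue $\|A_\Phi\|_\infty$ (basis independent), and set $\gamma(\Phi)=\frac1k+\left(1-\frac1n\right)\|A_\Phi\|_\infty$ if $n\ge k\|A_\Phi\|_\infty$ and $\gamma(\Phi)=\|A_\Phi\|_\infty$ otherwise. (The condition $\gamma(\Phi)=\|\Phi\|_{1\to2}^2$ is called $\mathcal C_{add}$ in the paper.) *)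

(* Defs.v *)
From HB Require Import structures.
From mathcomp Require Import all_boot all_order all_algebra.
From mathcomp Require Import sesquilinear spectral.
From mathcomp Require Import complex.
From mathcomp Require Import classical_sets reals exp.

Set Implicit Arguments.
Unset Strict Implicit.
Unset Printing Implicit Defensive.

Import Order.TTheory GRing.Theory Num.Theory.
Local Open Scope ring_scope.
Local Open Scope classical_set_scope.

Section QDefs.
Variable R : realType.
Local Notation C := (R[i]).

(* real part of a complex number (used on quantities that are real) *)
Definition toR (z : C) : R := complex.Re z.

Definition adj {p q : nat} (A : 'M[C]_(p, q)) : 'M[C]_(q, p) := (map_mx Num.conj A)^T.

Definition herm {n : nat} (A : 'M[C]_n) : Prop := adj A = A.

Definition psd {n : nat} (A : 'M[C]_n) : Prop :=
  herm A /\ forall v : 'rV[C]_n, 0 <= (v *m A *m adj v) 0 0.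

Definition density {n : nat} (rho : 'M[C]_n) : Prop := psd rho /\ \tr rho = 1.

Definition trnorm {n : nat} (rho : 'M[C]_n) : R :=
  toR (\sum_(i < n) `|spectral_diag rho 0 i|).
Definition hsnorm {p q : nat} (X : 'M[C]_(p, q)) : R :=
  Num.sqrt (toR (\tr (X *m adj X))).

(* Kronecker product: index p of 'I_(n * m) corresponds to the pair
   (i, a) with p = mxvec_index i a. *)
Definition idx_pair {n m : nat} (p : 'I_(n * m)) : 'I_n * 'I_m :=
  enum_val (cast_ord (esym (mxvec_cast n m)) p).
Definition kron {n m : nat} (A : 'M[C]_n) (B : 'M[C]_m) : 'M[C]_(n * m) :=
  \matrix_(p, q) (A (idx_pair p).1 (idx_pair q).1 * B (idx_pair p).2 (idx_pair q).2).

(* Tensor product of linear maps Phi : M_n -> M_k and Omega : M_m -> M_l,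
   defined on the matrix-unit basis: (Phi (x) Omega)(E_ij (x) E_ab) =
   Phi(E_ij) (x) Omega(E_ab), extended linearly. *)
Definition tens_map {n k m l : nat} (Phi : 'M[C]_n -> 'M[C]_k)
    (Omega : 'M[C]_m -> 'M[C]_l) (X : 'M[C]_(n * m)) : 'M[C]_(k * l) :=
  \sum_(i < n) \sum_(j < n) \sum_(a < m) \sum_(b < m)
     X (mxvec_index i a) (mxvec_index j b)
       *: kron (Phi (delta_mx i j)) (Omega (delta_mx a b)).

Definition herm_preserving {n k : nat} (Phi : 'M[C]_n -> 'M[C]_k) : Prop :=
  forall X, herm X -> herm (Phi X).

Definition trace_preserving {n k : nat} (Phi : 'M[C]_n -> 'M[C]_k) : Prop :=
  forall X, herm X -> \tr (Phi X) = \tr X.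

Definition unital {n k : nat} (Phi : 'M[C]_n -> 'M[C]_k) : Prop :=
  Phi (n%:R^-1 *: 1%:M) = k%:R^-1 *: 1%:M.

Definition positive_map {n k : nat} (Phi : 'M[C]_n -> 'M[C]_k) : Prop :=
  forall X, psd X -> psd (Phi X).

Definition completely_positive {n k : nat} (Phi : 'M[C]_n -> 'M[C]_k) : Prop :=
  forall p : nat, positive_map (tens_map (@id 'M[C]_p) Phi).

Definition quantum_channel {n k : nat} (Phi : 'M[C]_n -> 'M[C]_k) : Prop :=
  completely_positive Phi /\ trace_preserving Phi.

Definition norm12 {n k : nat} (Phi : 'M[C]_n -> 'M[C]_k) : R :=
  sup [set hsnorm (Phi rho) / trnorm rho | rho in [set rho : 'M[C]_n | herm rho /\ rho != 0]].

Definition S2 {k : nat} (sigma : 'M[C]_k) : R := - ln (toR (\tr (sigma *m sigma))).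
Definition Smin2 {n k : nat} (Phi : 'M[C]_n -> 'M[C]_k) : R :=
  inf [set S2 (Phi rho) | rho in [set rho : 'M[C]_n | density rho]].

Definition onb_traceless {n : nat} (M : 'I_(n ^ 2 - 1) -> 'M[C]_n) : Prop :=
  (forall i, herm (M i) /\ \tr (M i) = 0) /\
  (forall i j, \tr (M i *m M j) = (i == j)%:R).

Definition A_mat {n k : nat} (Phi : 'M[C]_n -> 'M[C]_k)
    (M : 'I_(n ^ 2 - 1) -> 'M[C]_n) : 'M[R]_(n ^ 2 - 1) :=
  \matrix_(i, j) toR (\tr (Phi (M i) *m Phi (M j))).

Definition lambda_max {d : nat} (A : 'M[R]_d) : R := sup [set a : R | eigenvalue A a].

Definition gamma {n k : nat} (Phi : 'M[C]_n -> 'M[C]_k)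
    (M : 'I_(n ^ 2 - 1) -> 'M[C]_n) : R :=
  let a := lambda_max (A_mat Phi M) in
  if k%:R * a <= n%:R then k%:R^-1 + (1 - n%:R^-1) * a else a.

Definition Cadd {n k : nat} (Phi : 'M[C]_n -> 'M[C]_k) : Prop :=
  exists M, onb_traceless M /\ gamma Phi M = norm12 Phi ^+ 2.

Fixpoint pdim (ns : nat -> nat) (N : nat) : nat :=
  match N with 0 => 1 | N'.+1 => (pdim ns N' * ns N')%N end.

Fixpoint tens_fam (ns ks : nat -> nat)
    (Phis : forall i, 'M[C]_(ns i) -> 'M[C]_(ks i)) (N : nat) :
    'M[C]_(pdim ns N) -> 'M[C]_(pdim ks N) :=
  match N return 'M[C]_(pdim ns N) -> 'M[C]_(pdim ks N) with
  | 0 => fun X : 'M[C]_1 => X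
  | N'.+1 => tens_map (@tens_fam ns ks Phis N') (Phis N')
  end.

End QDefs.
Arguments tens_fam {R ns ks} Phis N _.

(* Main.v *)
(* Fix an orthonormal basis of the traceless Hermitian matrices and let lam be
   the largest eigenvalue of A_Phi. Splitting off the trace gives, for every
   complex matrix X,
     |Phi X|_2^2 <= (1/k - lam/n) |tr X|^2 + lam |X|_2^2.
   Applied entrywise in the second tensor factor to (id (x) Omega) rho, this is
     |(Phi (x) Omega) rho|_2^2
        <= (1/k - lam/n) |Omega (tr_1 rho)|_2^2 + lam |(id (x) Omega) rho|_2^2,
   and both norms on the right are at most |Omega|_{1->2} tr rho: for the second
   one, a positive block matrix P = X X^* satisfies
   |P_ij|_2^2 <= |P_ii|_2 |P_jj|_2 (Cauchy-Schwarz for X_i^* X_i and X_j^* X_j),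
   hence |P|_2 <= sum_i |P_ii|_2. According to the sign of 1/k - lam/n this
   yields the bound gamma(Phi) |Omega|^2 = |Phi|^2 |Omega|^2; product states give
   the converse. Finally S_min,2 = - ln |.|_{1->2}^2 for channels. In part (2)
   the role of Omega is played by the product of the first N maps, which is
   completely positive because Kraus operators tensor. *)
Require Import Defs.
From HB Require Import structures.
From mathcomp Require Import all_boot all_order all_algebra.
From mathcomp Require Import sesquilinear spectral complex.
From mathcomp Require Import classical_sets reals exp.
From mathcomp Require Import ring lra.
Import Order.TTheory GRing.Theory Num.Theory.
Local Open Scope ring_scope.

Set Implicit Arguments.
Unset Strict Implicit.
Unset Printing Implicit Defensive.

(** * The Hilbert-Schmidt inner product *)

Section Frobenius.
Variable R : realType.
Local Notation C := R[i].

Lemma toRD (x y : C) : toR (x + y) = toR x + toR y.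
Proof. by case: x => a b; case: y => c d. Qed.

Lemma toR_sum (I : finType) (F : I -> C) :
  toR (\sum_i F i) = \sum_i toR (F i).
Proof. by elim/big_ind2: _ => // x a y b <- <-; rewrite toRD. Qed.

Lemma toR_real (a : R) : toR a%:C%C = a. Proof. by []. Qed.

Lemma toRMreal (a : R) (x : C) : toR (a%:C%C * x) = a * toR x.
Proof. by case: x => b c; rewrite /toR /= mul0r subr0. Qed.

Lemma toRM_conj (x y : C) :
  toR (x * Num.conj y) = complex.Re x * complex.Re y + complex.Im x * complex.Im y.
Proof. by case: x => a b; case: y => c d; rewrite /toR /= mulrN opprK. Qed.

Lemma ge0_toR (x : C) : 0 <= x -> x = (toR x)%:C%C /\ 0 <= toR x.
Proof. by case: x => a b; rewrite lecE /= => /andP[/eqP -> ->]. Qed.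

Lemma conj_real (a : R) : Num.conj (a%:C%C : C) = a%:C%C.
Proof. exact: conjc_real. Qed.

Lemma adjE {p q} (A : 'M[C]_(p, q)) i j : adj A i j = Num.conj (A j i).
Proof. by rewrite !mxE. Qed.

Lemma adjD {p q} (A B : 'M[C]_(p, q)) : adj (A + B) = adj A + adj B.
Proof. by apply/matrixP => i j; rewrite !mxE rmorphD. Qed.

Lemma adjB {p q} (A B : 'M[C]_(p, q)) : adj (A - B) = adj A - adj B.
Proof. by apply/matrixP => i j; rewrite !mxE rmorphB. Qed.

Lemma adj_scale {p q} (a : C) (A : 'M[C]_(p, q)) : adj (a *: A) = Num.conj a *: adj A.
Proof. by apply/matrixP => i j; rewrite !mxE rmorphM. Qed.

Lemma adjK {p q} (A : 'M[C]_(p, q)) : adj (adj A) = A.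
Proof. by apply/matrixP => i j; rewrite !mxE conjCK. Qed.

Lemma adjM {p q r} (A : 'M[C]_(p, q)) (B : 'M[C]_(q, r)) :
  adj (A *m B) = adj B *m adj A.
Proof. by rewrite /adj map_mxM trmx_mul. Qed.

Lemma adj_scalar1 {n} : adj (1%:M : 'M[C]_n) = 1%:M.
Proof. by apply/matrixP => i j; rewrite !mxE eq_sym conjC_nat. Qed.

Lemma tr_adj {n} (A : 'M[C]_n) : \tr (adj A) = Num.conj (\tr A).
Proof. by rewrite /adj mxtrace_tr /mxtrace rmorph_sum; apply: eq_bigr => i _; rewrite !mxE. Qed.

(** Taking the real part makes the form symmetric and bilinear over the reals on all complex
    matrices, so the real Cauchy-Schwarz argument applies. *)
Definition rdot {p q} (X Y : 'M[C]_(p, q)) : R := toR (\tr (X *m adj Y)).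
Definition sqn {p q} (X : 'M[C]_(p, q)) : R := rdot X X.

Lemma rdotE {p q} (X Y : 'M[C]_(p, q)) : rdot X Y =
  \sum_i \sum_j toR (X i j * Num.conj (Y i j)).
Proof.
rewrite /rdot /mxtrace toR_sum; apply: eq_bigr => i _.
by rewrite mxE toR_sum; apply: eq_bigr => j _; rewrite adjE.
Qed.

Lemma rdotC {p q} (X Y : 'M[C]_(p, q)) : rdot X Y = rdot Y X.
Proof.
by rewrite !rdotE; apply: eq_bigr => i _; apply: eq_bigr => j _;
  rewrite !toRM_conj; congr (_ + _); rewrite mulrC.
Qed.

Lemma rdotDl {p q} (X Y Z : 'M[C]_(p, q)) : rdot (X + Y) Z = rdot X Z + rdot Y Z.
Proof. by rewrite /rdot mulmxDl mxtraceD toRD. Qed.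

Lemma rdotDr {p q} (X Y Z : 'M[C]_(p, q)) : rdot X (Y + Z) = rdot X Y + rdot X Z.
Proof. by rewrite rdotC rdotDl !(rdotC X). Qed.

Lemma rdotZl {p q} (a : R) (X Y : 'M[C]_(p, q)) : rdot (a%:C%C *: X) Y = a * rdot X Y.
Proof. by rewrite /rdot -scalemxAl mxtraceZ toRMreal. Qed.

Lemma rdotZr {p q} (a : R) (X Y : 'M[C]_(p, q)) : rdot X (a%:C%C *: Y) = a * rdot X Y.
Proof. by rewrite rdotC rdotZl rdotC. Qed.

Lemma rdot_suml {p q} (I : finType) (F : I -> 'M[C]_(p, q)) Y :
  rdot (\sum_i F i) Y = \sum_i rdot (F i) Y.
Proof.
by elim/big_ind2: _ => [|x a y b <- <-|//]; rewrite ?rdotDl // /rdot mul0mx mxtrace0.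
Qed.

Lemma rdot_sumr {p q} (I : finType) (F : I -> 'M[C]_(p, q)) Y :
  rdot Y (\sum_i F i) = \sum_i rdot Y (F i).
Proof. by rewrite rdotC rdot_suml; apply: eq_bigr => i _; rewrite rdotC. Qed.

Definition sqc (z : C) : R := toR (z * Num.conj z).

Lemma sqc_ge0 z : 0 <= sqc z.
Proof. by rewrite /sqc toRM_conj addr_ge0 // -expr2 sqr_ge0. Qed.

Lemma sqcM x y : sqc (x * y) = sqc x * sqc y.
Proof. by rewrite /sqc !toRM_conj; case: x => a b; case: y => c d /=; ring. Qed.

Lemma sqnE {p q} (X : 'M[C]_(p, q)) : sqn X = \sum_i \sum_j sqc (X i j).
Proof. exact: rdotE. Qed.

Lemma sqn_ge0 {p q} (X : 'M[C]_(p, q)) : 0 <= sqn X.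
Proof. by rewrite sqnE; do 2!apply: sumr_ge0 => ? _; exact: sqc_ge0. Qed.

Lemma sqn_eq0 {p q} (X : 'M[C]_(p, q)) : sqn X = 0 -> X = 0.
Proof.
move=> /eqP; rewrite sqnE psumr_eq0; last first.
  by move=> i _; apply: sumr_ge0 => ? _; exact: sqc_ge0.
move=> /allP h; apply/matrixP => i j; rewrite mxE.
move: (h i); rewrite mem_index_enum => /(_ isT); rewrite implyTb psumr_eq0; last first.
  by move=> ? _; exact: sqc_ge0.
move=> /allP /(_ j); rewrite mem_index_enum => /(_ isT); rewrite implyTb.
rewrite /sqc toRM_conj -!expr2 paddr_eq0 ?sqr_ge0 // !sqrf_eq0.
by case: (X i j) => a b /= /andP[/eqP -> /eqP ->].
Qed.

Lemma rdot0l {p q} (Y : 'M[C]_(p, q)) : rdot 0 Y = 0.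
Proof. by rewrite /rdot mul0mx mxtrace0. Qed.

Lemma rdot_cauchy_schwarz {p q} (X Y : 'M[C]_(p, q)) :
  rdot X Y ^+ 2 <= sqn X * sqn Y.
Proof.
have [Y0|Y0] := eqVneq (sqn Y) 0.
  by rewrite (sqn_eq0 Y0) rdotC rdot0l expr0n /= mulr_ge0 ?sqn_ge0.
have Yp : 0 < sqn Y by rewrite lt_def Y0 sqn_ge0.
(* The matrix |Y|^2 X - <X,Y> Y has squared norm |Y|^2 (|X|^2 |Y|^2 - <X,Y>^2), from which the
   positive factor |Y|^2 cancels. *)
have := sqn_ge0 ((sqn Y)%:C%C *: X + (- rdot X Y)%:C%C *: Y).
rewrite {1}/sqn !rdotDl !rdotDr !rdotZl !rdotZr (rdotC Y X) -/(sqn X) -/(sqn Y).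
move=> h; rewrite -subr_ge0 -(pmulr_rge0 _ Yp).
by apply: le_trans h _; rewrite le_eqVlt; apply/orP; left; apply/eqP; ring.
Qed.

Lemma hsnormE {p q} (X : 'M[C]_(p, q)) : hsnorm X = Num.sqrt (sqn X).
Proof. by []. Qed.

Lemma hsnorm_ge0 {p q} (X : 'M[C]_(p, q)) : 0 <= hsnorm X.
Proof. exact: sqrtr_ge0. Qed.

Lemma sqr_hsnorm {p q} (X : 'M[C]_(p, q)) : hsnorm X ^+ 2 = sqn X.
Proof. by rewrite hsnormE sqr_sqrtr ?sqn_ge0. Qed.

Lemma hsnorm0 {p q} : hsnorm (0 : 'M[C]_(p, q)) = 0.
Proof. by rewrite hsnormE /sqn rdot0l sqrtr0. Qed.

Lemma rdot_le {p q} (X Y : 'M[C]_(p, q)) : rdot X Y <= hsnorm X * hsnorm Y.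
Proof.
apply: le_trans (ler_norm _) _; rewrite -sqrtr_sqr hsnormE hsnormE -sqrtrM ?sqn_ge0 //.
by rewrite ler_wsqrtr // rdot_cauchy_schwarz.
Qed.

Lemma hsnormD {p q} (X Y : 'M[C]_(p, q)) : hsnorm (X + Y) <= hsnorm X + hsnorm Y.
Proof.
rewrite -(@ler_pXn2r _ 2) ?nnegrE ?addr_ge0 ?hsnorm_ge0 // sqr_hsnorm.
rewrite sqrrD !sqr_hsnorm {1}/sqn !rdotDl !rdotDr (rdotC Y X) -/(sqn X) -/(sqn Y).
by have := rdot_le X Y; lra.
Qed.

Lemma hsnorm_sum (I : finType) {p q} (F : I -> 'M[C]_(p, q)) :
  hsnorm (\sum_i F i) <= \sum_i hsnorm (F i).
Proof.
elim/big_ind2: _ => [|x a y b hx hy|//]; first by rewrite hsnorm0.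
exact: le_trans (hsnormD _ _) (lerD hx hy).
Qed.

Lemma sqnZ {p q} (a : C) (X : 'M[C]_(p, q)) : sqn (a *: X) = sqc a * sqn X.
Proof.
rewrite !sqnE mulr_sumr; apply: eq_bigr => i _; rewrite mulr_sumr.
by apply: eq_bigr => j _; rewrite mxE sqcM.
Qed.

Lemma hsnormZ {p q} (a : C) (X : 'M[C]_(p, q)) :
  hsnorm (a *: X) = Num.sqrt (sqc a) * hsnorm X.
Proof. by rewrite !hsnormE sqnZ sqrtrM ?sqc_ge0. Qed.

Lemma hsnormN {p q} (X : 'M[C]_(p, q)) : hsnorm (- X) = hsnorm X.
Proof.
rewrite -scaleN1r hsnormZ (_ : sqc (-1) = 1) ?sqrtr1 ?mul1r //.
by rewrite /sqc toRM_conj /=; ring.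
Qed.

Lemma sqc_le_sqn {p q} (X : 'M[C]_(p, q)) i j : sqc (X i j) <= sqn X.
Proof.
rewrite sqnE (bigD1 i) //= (bigD1 j) //= -addrA lerDl addr_ge0 //.
  by apply: sumr_ge0 => ? _; exact: sqc_ge0.
by do 2!apply: sumr_ge0 => ? _; exact: sqc_ge0.
Qed.

End Frobenius.

(** * Positive semidefinite matrices and the trace norm *)

Section Positive.
Variable R : realType.
Local Notation C := R[i].

(** The spectral theorem with real eigenvalues; the last clause ties them to [spectral_diag],
    through which [trnorm] is defined. *)
Lemma herm_spectral {n} (A : 'M[C]_n) : herm A ->
  exists (P : 'M[C]_n) (d : 'I_n -> R),
    [/\ adj P *m P = 1%:M, P *m adj P = 1%:M,
        A = adj P *m diag_mx (\row_i (d i)%:C%C) *m P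
      & forall i, spectral_diag A 0 i = (d i)%:C%C].
Proof.
move=> hA; have hsA : A \is hermsymmx.
  by apply/is_hermitianmxP; rewrite expr0 scale1r -[LHS]hA /adj map_trmx.
have /orthomx_spectralP eA := hermitian_normalmx hsA.
have /mxOverP dr := hermitian_spectral_diag_real hsA.
have adjP : adj (spectralmx A) = map_mx Num.conj ((spectralmx A)^T) by rewrite /adj map_trmx.
have Pu := spectral_unitarymx A; have /unitarymxP PP := Pu.
have eP : invmx (spectralmx A) = adj (spectralmx A) by rewrite invmx_unitary // adjP.
have ed i : spectral_diag A 0 i = (toR (spectral_diag A 0 i))%:C%C.
  by rewrite /toR RRe_real // dr.
exists (spectralmx A), (fun i => toR (spectral_diag A 0 i)); split => //.
- by rewrite -eP mulVmx // unitarymx_unit.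
- by rewrite -eP mulmxV // unitarymx_unit.
- rewrite -eP [LHS]eA; congr (_ *m diag_mx _ *m _).
  by apply/rowP => i; rewrite mxE -ed.
Qed.

Lemma mul_adj_ge0 {q} (w : 'rV[C]_q) : 0 <= (w *m adj w) 0 0.
Proof. by rewrite mxE sumr_ge0 // => i _; rewrite adjE mul_conjC_ge0. Qed.

Lemma psd_gram {n q} (X : 'M[C]_(n, q)) : psd (X *m adj X).
Proof.
split; first by rewrite /herm adjM adjK.
by move=> v; rewrite mulmxA -mulmxA -adjM mul_adj_ge0.
Qed.

Lemma psd_conj {n q} (K : 'M[C]_(q, n)) (A : 'M[C]_n) :
  psd A -> psd (K *m A *m adj K).
Proof.
move=> [hA pA]; split; first by rewrite /herm !adjM adjK hA mulmxA.
by move=> v; rewrite !mulmxA -[_ *m adj K *m adj v]mulmxA -adjM.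
Qed.

Lemma psdD {n} (A B : 'M[C]_n) : psd A -> psd B -> psd (A + B).
Proof.
move=> [hA pA] [hB pB]; split; first by rewrite /herm adjD hA hB.
by move=> v; rewrite mulmxDr mulmxDl mxE addr_ge0.
Qed.

Lemma psd0 {n} : psd (0 : 'M[C]_n).
Proof.
split; first by apply/matrixP => i j; rewrite !mxE conjC0.
by move=> v; rewrite mulmx0 mul0mx mxE.
Qed.

Lemma psd_sum (I : finType) {n} (F : I -> 'M[C]_n) :
  (forall i, psd (F i)) -> psd (\sum_i F i).
Proof. by move=> h; elim/big_ind: _ => //; [exact: psd0 | exact: psdD]. Qed.

Lemma diag_sqrt_gram {n} (d : 'I_n -> R) : (forall i, 0 <= d i) ->
  diag_mx (\row_i (d i)%:C%C) = diag_mx (\row_i (Num.sqrt (d i))%:C%C) *m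
                 adj (diag_mx (\row_i (Num.sqrt (d i))%:C%C)) :> 'M[C]_n.
Proof.
move=> d0; apply/matrixP => i j; rewrite mul_diag_mx !mxE; case: eqVneq => [->|ij].
  rewrite !mulr1n [X in _ * X]conj_real -[RHS]rmorphM /=.
  by rewrite -expr2 sqr_sqrtr.
by rewrite !mulr0n conjC0 mulr0.
Qed.

Lemma psd_diag {n} (d : 'I_n -> R) : (forall i, 0 <= d i) ->
  psd (diag_mx (\row_i (d i)%:C%C)).
Proof. by move=> /diag_sqrt_gram ->; exact: psd_gram. Qed.

Lemma psd_diag_ge0 {n} (A : 'M[C]_n) i : psd A -> 0 <= A i i.
Proof.
move=> [_ /(_ (delta_mx 0 i))]; rewrite -rowE mxE (bigD1 i) //= big1 => [|j ji].
  by rewrite adjE !mxE !eqxx conjC1 mulr1 addr0.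
by rewrite adjE !mxE (negbTE ji) andbF conjC0 mulr0.
Qed.

Lemma psd_tr {n} (A : 'M[C]_n) : psd A -> \tr A = (toR (\tr A))%:C%C /\ 0 <= toR (\tr A).
Proof. by move=> pA; apply: ge0_toR; apply: sumr_ge0 => i _; exact: psd_diag_ge0. Qed.

Lemma psd_spectral {n} (A : 'M[C]_n) : psd A ->
  exists (P : 'M[C]_n) (d : 'I_n -> R),
    [/\ P *m adj P = 1%:M, forall i, 0 <= d i,
        A = adj P *m diag_mx (\row_i (d i)%:C%C) *m P
      & forall i, spectral_diag A 0 i = (d i)%:C%C].
Proof.
move=> pA; have [P [d [PP1 PP2 eA sA]]] := herm_spectral pA.1.
exists P, d; split => // i.
(* The eigenvalues are the diagonal entries of P A P^*, which is again positive. *)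
have := psd_diag_ge0 i (psd_conj P pA).
rewrite eA !mulmxA PP2 mul1mx -mulmxA PP2 mulmx1 !mxE eqxx mulr1n.
by rewrite lecE /= => /andP[].
Qed.

(** Scaling the eigenbasis by the square roots of the eigenvalues gives the factor. Positivity is
    mostly used below through this Gram form. *)
Lemma psd_factor {n} (A : 'M[C]_n) : psd A -> exists X : 'M[C]_n, A = X *m adj X.
Proof.
move=> pA; have [P [d [PP d0 -> _]]] := psd_spectral pA.
exists (adj P *m diag_mx (\row_i (Num.sqrt (d i))%:C%C)).
by rewrite diag_sqrt_gram // adjM adjK !mulmxA.
Qed.

Lemma tr_conj_unitary {n} (P D : 'M[C]_n) : P *m adj P = 1%:M ->
  \tr (adj P *m D *m P) = \tr D.
Proof. by move=> PP; rewrite mxtrace_mulC mulmxA PP mul1mx. Qed.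

Lemma tr_diag_real {n} (d : 'I_n -> R) :
  toR (\tr (diag_mx (\row_i (d i)%:C%C))) = \sum_i d i.
Proof. by rewrite mxtrace_diag toR_sum; apply: eq_bigr => i _; rewrite mxE. Qed.

Lemma norm_real_complex (a : R) : `|a%:C%C| = `|a|%:C%C :> C.
Proof. by rewrite normc_def /= expr0n addr0 sqrtr_sqr. Qed.

Lemma trnorm_psd {n} (A : 'M[C]_n) : psd A -> trnorm A = toR (\tr A).
Proof.
move=> pA; have [P [d [PP d0 eA sA]]] := psd_spectral pA.
rewrite [in RHS]eA tr_conj_unitary // tr_diag_real /trnorm toR_sum.
by apply: eq_bigr => i _; rewrite sA norm_real_complex ger0_norm.
Qed.

Lemma trnorm_ge0 {n} (A : 'M[C]_n) : 0 <= trnorm A.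
Proof.
rewrite /trnorm toR_sum; apply: sumr_ge0 => i _.
by have [] := ge0_toR (normr_ge0 (spectral_diag A 0 i)).
Qed.

(** Jordan decomposition: splitting each eigenvalue into positive and negative parts in one
    eigenbasis makes the trace norm additive. It reduces bounds on Hermitian matrices to positive
    ones. *)
Lemma herm_pos_neg {n} (A : 'M[C]_n) : herm A ->
  exists B D, [/\ psd B, psd D, A = B - D & trnorm A = toR (\tr B) + toR (\tr D)].
Proof.
move=> hA; have [P [d [_ PP eA sA]]] := herm_spectral hA.
pose f i := (`|d i| + d i) / 2; pose g i := (`|d i| - d i) / 2.
pose S e := adj P *m diag_mx (\row_i (e i)%:C%C) *m P : 'M[C]_n.
have pS e : (forall i, 0 <= e i) -> psd (S e).
  by move=> e0; have := psd_conj (adj P) (psd_diag e0); rewrite adjK.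
exists (S f), (S g); split.
- by apply: pS => i; rewrite divr_ge0 // -lerBlDr sub0r ler_normr lexx orbT.
- by apply: pS => i; rewrite divr_ge0 // subr_ge0 ler_norm.
- rewrite eA /S -mulmxBl -mulmxBr; congr (_ *m _ *m _).
  rewrite -raddfB /=; congr diag_mx; apply/rowP => i; rewrite !mxE -rmorphB.
  by congr (_%:C%C); rewrite /f /g; field.
- rewrite /S !tr_conj_unitary // !tr_diag_real -big_split /trnorm toR_sum.
  by apply: eq_bigr => i _; rewrite sA norm_real_complex toR_real /f /g /=; field.
Qed.

End Positive.

(** * Block matrices and the norm from trace to Hilbert-Schmidt *)

Section Blocks.
Variable R : realType.
Local Notation C := R[i].

Lemma idx_pairK {n m} (i : 'I_n) (a : 'I_m) : idx_pair (mxvec_index i a) = (i, a).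
Proof. by rewrite /idx_pair /mxvec_index cast_ordK enum_rankK. Qed.

Lemma mxvec_index_inj {n m} (i j : 'I_n) (a b : 'I_m) :
  (mxvec_index i a == mxvec_index j b) = (i == j) && (a == b).
Proof.
apply/eqP/andP => [/(congr1 idx_pair)|[/eqP -> /eqP ->] //].
by rewrite !idx_pairK => -[-> ->].
Qed.

Lemma sum_mxvec_index {V : nmodType} {n m} (F : 'I_(n * m) -> V) :
  \sum_p F p = \sum_i \sum_a F (mxvec_index i a).
Proof.
by rewrite pair_bigA (reindex _ (curry_mxvec_bij _ _)); apply: eq_bigr => -[].
Qed.

Lemma mxvec_index_matrixP {n m k l} (A B : 'M[C]_(n * m, k * l)) :
  (forall i a j b, A (mxvec_index i a) (mxvec_index j b) =
                   B (mxvec_index i a) (mxvec_index j b)) -> A = B.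
Proof.
move=> h; apply/matrixP => p q.
by case/mxvec_indexP: p => i a; case/mxvec_indexP: q => j b.
Qed.

Definition block {n m} (X : 'M[C]_(n * m)) (i j : 'I_n) : 'M[C]_m :=
  \matrix_(a, b) X (mxvec_index i a) (mxvec_index j b).

(** The counterpart of [block]: here the indices in the second tensor factor are fixed, so that a
    map on the first factor acts on each coblock separately. *)
Definition coblock {n m} (X : 'M[C]_(n * m)) (a b : 'I_m) : 'M[C]_n :=
  \matrix_(i, j) X (mxvec_index i a) (mxvec_index j b).

Definition ptrace {n m} (X : 'M[C]_(n * m)) : 'M[C]_m := \sum_i block X i i.

Lemma sqn_block {n m} (X : 'M[C]_(n * m)) : sqn X = \sum_i \sum_j sqn (block X i j).
Proof.
rewrite sqnE sum_mxvec_index; apply: eq_bigr => i _.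
under eq_bigr do rewrite sum_mxvec_index.
rewrite exchange_big; apply: eq_bigr => j _; rewrite sqnE.
by apply: eq_bigr => a _; apply: eq_bigr => b _; rewrite mxE.
Qed.

Lemma sqn_coblock {n m} (X : 'M[C]_(n * m)) : sqn X = \sum_a \sum_b sqn (coblock X a b).
Proof.
rewrite sqnE sum_mxvec_index exchange_big; apply: eq_bigr => a _.
under [LHS]eq_bigr do rewrite sum_mxvec_index exchange_big.
rewrite exchange_big; apply: eq_bigr => b _; rewrite sqnE.
by apply: eq_bigr => i _; apply: eq_bigr => j _; rewrite mxE.
Qed.

Lemma tr_ptrace {n m} (X : 'M[C]_(n * m)) : \tr (ptrace X) = \tr X.
Proof.
rewrite /ptrace raddf_sum /= [RHS]sum_mxvec_index; apply: eq_bigr => i _.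
by apply: eq_bigr => a _; rewrite mxE.
Qed.

Definition rowblock {n m q} (X : 'M[C]_(n * m, q)) (i : 'I_n) : 'M[C]_(m, q) :=
  \matrix_(a, s) X (mxvec_index i a) s.

Lemma block_gram {n m q} (X : 'M[C]_(n * m, q)) i j :
  block (X *m adj X) i j = rowblock X i *m adj (rowblock X j).
Proof.
apply/matrixP => a b; rewrite !mxE; apply: eq_bigr => s _.
by rewrite !mxE.
Qed.

Lemma psd_block {n m} (P : 'M[C]_(n * m)) i : psd P -> psd (block P i i).
Proof. by move=> /psd_factor[X ->]; rewrite block_gram; exact: psd_gram. Qed.

Lemma psd_ptrace {n m} (P : 'M[C]_(n * m)) : psd P -> psd (ptrace P).
Proof. by move=> pP; apply: psd_sum => i; exact: psd_block. Qed.

Lemma hsnorm_gramC {p q} (X : 'M[C]_(p, q)) : hsnorm (adj X *m X) = hsnorm (X *m adj X).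
Proof.
rewrite !hsnormE /sqn /rdot !adjM !adjK; congr Num.sqrt; congr toR.
by rewrite -mulmxA mxtrace_mulC !mulmxA.
Qed.

(** By cyclicity of the trace |X Y^*|^2 = <X^* X, Y^* Y>; then Cauchy-Schwarz applies. *)
Lemma sqn_mul_adj_le {p r q} (X : 'M[C]_(p, q)) (Y : 'M[C]_(r, q)) :
  sqn (X *m adj Y) <= hsnorm (X *m adj X) * hsnorm (Y *m adj Y).
Proof.
rewrite -!hsnorm_gramC; apply: le_trans (rdot_le _ _).
rewrite le_eqVlt; apply/orP; left; apply/eqP; rewrite /sqn /rdot !adjM !adjK.
by congr toR; rewrite [RHS]mxtrace_mulC -[in LHS]mulmxA [LHS]mxtrace_mulC !mulmxA.
Qed.

Lemma hsnorm_psd_block {n m} (P : 'M[C]_(n * m)) : psd P ->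
  hsnorm P <= \sum_i hsnorm (block P i i).
Proof.
move=> /psd_factor[X ->]; set h := \sum_i _.
have h0 : 0 <= h by apply: sumr_ge0 => i _; exact: hsnorm_ge0.
rewrite -(@ler_pXn2r _ 2) ?nnegrE ?hsnorm_ge0 // sqr_hsnorm sqn_block.
(* The square of h is the double sum of |P_ii| |P_jj|, compared term by term with that of
   |P_ij|^2. *)
rewrite expr2 {1}/h mulr_suml; apply: ler_sum => i _.
rewrite /h mulr_sumr; apply: ler_sum => j _; rewrite !block_gram.
exact: sqn_mul_adj_le.
Qed.

(** The block estimate with blocks of size 1: the rows of a Gram factor play the role of the block
    rows. *)
Lemma hsnorm_psd_tr {n} (P : 'M[C]_n) : psd P -> hsnorm P <= toR (\tr P).
Proof.
move=> pP; rewrite /mxtrace toR_sum.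
move: (pP) => /psd_factor[X eP].
have h0 : 0 <= \sum_i toR (P i i).
  by apply: sumr_ge0 => i _; case: (ge0_toR (psd_diag_ge0 i pP)).
rewrite -(@ler_pXn2r _ 2) ?nnegrE ?hsnorm_ge0 // sqr_hsnorm sqnE.
have Pe i j : P i j = (row i X *m adj (row j X)) 0 0.
  by rewrite eP !mxE; apply: eq_bigr => s _; rewrite !mxE.
have e11 (Z : 'M[C]_1) : sqn Z = sqc (Z 0 0) by rewrite sqnE !big_ord1.
have h11 i : hsnorm (row i X *m adj (row i X)) = toR (P i i).
  rewrite hsnormE e11 -Pe; have [e p0] := ge0_toR (psd_diag_ge0 i pP).
  by rewrite e toR_real /sqc conj_real -rmorphM toR_real -expr2 sqrtr_sqr ger0_norm.
rewrite expr2 mulr_suml; apply: ler_sum => i _.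
rewrite mulr_sumr; apply: ler_sum => j _.
by rewrite Pe -e11 -!h11 sqn_mul_adj_le.
Qed.

Lemma psd_tr_eq0 {n} (P : 'M[C]_n) : psd P -> toR (\tr P) = 0 -> P = 0.
Proof.
move=> pP t0; apply: sqn_eq0; have := hsnorm_psd_tr pP; rewrite t0 => n0.
by rewrite -sqr_hsnorm (le_anti (introT andP (conj n0 (hsnorm_ge0 P)))) expr0n.
Qed.

Lemma lin_delta {n k} (T : {linear 'M[C]_n -> 'M[C]_k}) X :
  T X = \sum_i \sum_j X i j *: T (delta_mx i j).
Proof.
rewrite {1}[X]matrix_sum_delta linear_sum; apply: eq_bigr => i _.
by rewrite linear_sum; apply: eq_bigr => j _; rewrite linearZ_LR.
Qed.

(** A crude constant, whose purpose is to show that the supremum defining [norm12] is over a bounded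
    set. *)
Lemma lin_bounded {n k} (T : {linear 'M[C]_n -> 'M[C]_k}) :
  exists2 K, 0 <= K & forall X, hsnorm (T X) <= K * hsnorm X.
Proof.
exists (\sum_i \sum_j hsnorm (T (delta_mx i j))).
  by do 2!apply: sumr_ge0 => ? _; exact: hsnorm_ge0.
move=> X; rewrite lin_delta mulr_suml; apply: le_trans (hsnorm_sum _) _.
apply: ler_sum => i _; rewrite mulr_suml; apply: le_trans (hsnorm_sum _) _.
apply: ler_sum => j _; rewrite hsnormZ mulrC ler_wpM2l ?hsnorm_ge0 //.
by rewrite hsnormE ler_wsqrtr // sqc_le_sqn.
Qed.

(** * Reduction of the 1-to-2 norm to positive semidefinite inputs *)

Section Norm12.
Variables (n k : nat) (T : {linear 'M[C]_n -> 'M[C]_k}).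

Lemma psd_bound_trnorm (c : R) (X : 'M[C]_n) :
  (forall P, psd P -> hsnorm (T P) <= c * toR (\tr P)) ->
  herm X -> hsnorm (T X) <= c * trnorm X.
Proof.
move=> h /herm_pos_neg [B [D [pB pD -> ->]]].
rewrite raddfB /= mulrDr; apply: le_trans (hsnormD _ _) _; rewrite hsnormN.
by rewrite lerD ?h.
Qed.

Lemma norm12_le (c : R) : 0 <= c ->
  (forall P, psd P -> hsnorm (T P) <= c * toR (\tr P)) -> norm12 T <= c.
Proof.
move=> c0 h; rewrite /norm12.
set S := (X in sup X).
(* In dimension 0 there is no nonzero matrix, and the supremum of the empty set is 0 by
   convention. *)
have [/set0P neS|] := boolP (S != set0); last by rewrite negbK => /eqP ->; rewrite sup0.
apply: ge_sup neS _ => _ [rho [hr _] <-].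
have := psd_bound_trnorm h hr; have := trnorm_ge0 rho; rewrite [0 <= trnorm _]le_eqVlt.
(* A vanishing trace norm makes the quotient 0, since division by 0 returns 0. *)
case/orP => [/eqP <-|tp]; first by move=> _; rewrite invr0 mulr0.
by rewrite ler_pdivrMr.
Qed.

Lemma norm12_has_ubound :
  has_ubound [set hsnorm (T rho) / trnorm rho | rho in
     [set rho : 'M[C]_n | herm rho /\ rho != 0]]%classic.
Proof.
have [K K0 TK] := lin_bounded T; exists K => _ [rho [hr _] <-].
have h P : psd P -> hsnorm (T P) <= K * toR (\tr P).
  by move=> /hsnorm_psd_tr pP; apply: le_trans (TK P) _; rewrite ler_wpM2l.
have := psd_bound_trnorm h hr; have := trnorm_ge0 rho; rewrite [0 <= trnorm _]le_eqVlt.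
case/orP => [/eqP <-|tp]; first by move=> _; rewrite invr0 mulr0.
by rewrite ler_pdivrMr.
Qed.

Lemma hsnorm_le_norm12 P : psd P -> hsnorm (T P) <= norm12 T * toR (\tr P).
Proof.
move=> pP; have [->|P0] := eqVneq P 0.
  by rewrite raddf0 hsnorm0 mxtrace0 mulr0.
have tP : 0 < toR (\tr P).
  by rewrite lt_def (psd_tr pP).2 andbT; apply: contra_neq P0; exact: psd_tr_eq0.
rewrite -ler_pdivrMr // -(trnorm_psd pP).
apply: ub_le_sup; first exact: norm12_has_ubound.
by exists P => //; split => //; exact: pP.1.
Qed.

Lemma norm12_ge0 : 0 <= norm12 T.
Proof.
rewrite /norm12; set S := (X in sup X).
have [/set0P[x Sx]|] := boolP (S != set0); last by rewrite negbK => /eqP ->; rewrite sup0.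
apply: le_trans (ub_le_sup norm12_has_ubound Sx); case: Sx => rho _ <-.
by rewrite divr_ge0 ?hsnorm_ge0 ?trnorm_ge0.
Qed.

End Norm12.
End Blocks.

(** * Tensor products and Kraus operators *)

Section Tensor.
Variable R : realType.
Local Notation C := R[i].

Lemma tens_map_is_linear {n k m l : nat} (Phi : 'M[C]_n -> 'M[C]_k)
    (Omega : 'M[C]_m -> 'M[C]_l) : linear (tens_map Phi Omega).
Proof.
move=> a X Y; rewrite /tens_map scaler_sumr -big_split; apply: eq_bigr => i _.
rewrite scaler_sumr -big_split; apply: eq_bigr => j _.
rewrite scaler_sumr -big_split; apply: eq_bigr => b _.
rewrite scaler_sumr -big_split; apply: eq_bigr => c _ /=.
by rewrite !mxE scalerDl scalerA.
Qed.

HB.instance Definition _ n k m l (Phi : 'M[C]_n -> 'M[C]_k)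
    (Omega : 'M[C]_m -> 'M[C]_l) :=
  GRing.isLinear.Build C 'M[C]_(n * m) 'M[C]_(k * l) _ (tens_map Phi Omega)
    (tens_map_is_linear Phi Omega).

(** The rectangular form of [kron], for Kraus operators between spaces of different dimensions; on
    square matrices the two are convertible. *)
Definition tkron {n k m l} (A : 'M[C]_(n, k)) (B : 'M[C]_(m, l)) : 'M[C]_(n * m, k * l) :=
  \matrix_(p, q) (A (idx_pair p).1 (idx_pair q).1 * B (idx_pair p).2 (idx_pair q).2).

Lemma tkronE {n k m l} (A : 'M[C]_(n, k)) (B : 'M[C]_(m, l)) i a j b :
  tkron A B (mxvec_index i a) (mxvec_index j b) = A i j * B a b.
Proof. by rewrite mxE !idx_pairK. Qed.

Lemma kronE {n m} (A : 'M[C]_n) (B : 'M[C]_m) : kron A B = tkron A B.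
Proof. by []. Qed.

Lemma tkronM {n k m l p q} (A : 'M[C]_(n, k)) (B : 'M[C]_(m, l))
    (A' : 'M[C]_(k, p)) (B' : 'M[C]_(l, q)) :
  tkron A B *m tkron A' B' = tkron (A *m A') (B *m B').
Proof.
apply/mxvec_index_matrixP => i a j b; rewrite tkronE !mxE sum_mxvec_index mulr_suml.
apply: eq_bigr => c _; rewrite mulr_sumr; apply: eq_bigr => d _.
by rewrite !tkronE mulrACA.
Qed.

Lemma adj_tkron {n k m l} (A : 'M[C]_(n, k)) (B : 'M[C]_(m, l)) :
  adj (tkron A B) = tkron (adj A) (adj B).
Proof.
by apply/mxvec_index_matrixP => i a j b; rewrite adjE !tkronE !adjE rmorphM.
Qed.

Lemma sqn_kron {n m} (A : 'M[C]_n) (B : 'M[C]_m) : sqn (kron A B) = sqn A * sqn B.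
Proof.
rewrite sqn_block [in RHS]sqnE mulr_suml; apply: eq_bigr => i _.
rewrite mulr_suml; apply: eq_bigr => j _; rewrite -sqnZ; congr sqn.
by apply/matrixP => a b; rewrite !mxE !idx_pairK.
Qed.

Lemma hsnorm_kron {n m} (A : 'M[C]_n) (B : 'M[C]_m) :
  hsnorm (kron A B) = hsnorm A * hsnorm B.
Proof. by rewrite !hsnormE sqn_kron sqrtrM ?sqn_ge0. Qed.

Lemma tr_kron {n m} (A : 'M[C]_n) (B : 'M[C]_m) : \tr (kron A B) = \tr A * \tr B.
Proof.
rewrite /mxtrace sum_mxvec_index mulr_suml; apply: eq_bigr => i _.
by rewrite mulr_sumr; apply: eq_bigr => a _; rewrite kronE tkronE.
Qed.

Lemma psd_kron {n m} (A : 'M[C]_n) (B : 'M[C]_m) : psd A -> psd B -> psd (kron A B).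
Proof.
move=> /psd_factor[X ->] /psd_factor[Y ->].
by rewrite kronE -tkronM -adj_tkron; exact: psd_gram.
Qed.

Lemma kron_delta {n m} (i j : 'I_n) (a b : 'I_m) :
  kron (delta_mx i j) (delta_mx a b) =
  delta_mx (mxvec_index i a) (mxvec_index j b) :> 'M[C]_(n * m).
Proof.
apply/mxvec_index_matrixP => i' a' j' b'.
rewrite kronE tkronE !mxE !mxvec_index_inj -natrM mulnb; congr (_%:R).
by rewrite -!andbA; congr (nat_of_bool (_ && _)); rewrite andbCA.
Qed.

(* The coblock (u, v) of (id (x) Omega) X. *)
Definition slice {n m l} (Omega : 'M[C]_m -> 'M[C]_l) (X : 'M[C]_(n * m)) u v : 'M[C]_n :=
  \matrix_(i, j) Omega (block X i j) u v.

Section Linear.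
Variables (n k m l : nat).
Variables (Phi : {linear 'M[C]_n -> 'M[C]_k}) (Omega : {linear 'M[C]_m -> 'M[C]_l}).

(** Fixing the entry (u, v) in the second factor leaves [Phi] acting on one ordinary matrix, so
    inequalities for [Phi] alone can be applied entry by entry. *)
Lemma coblock_tens_map (X : 'M[C]_(n * m)) u v :
  coblock (tens_map Phi Omega X) u v = Phi (slice Omega X u v).
Proof.
rewrite [in RHS]lin_delta; apply/matrixP => c d; rewrite mxE /tens_map.
rewrite !summxE; apply: eq_bigr => i _; rewrite !summxE; apply: eq_bigr => j _.
rewrite !mxE (lin_delta Omega) !summxE mulr_suml.
apply: eq_bigr => a _; rewrite !summxE mulr_suml; apply: eq_bigr => b _.
by rewrite !mxE !idx_pairK /= mulrAC mulrA.
Qed.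

Lemma tens_mapE (X : 'M[C]_(n * m)) c u d v :
  tens_map Phi Omega X (mxvec_index c u) (mxvec_index d v) =
  Phi (slice Omega X u v) c d.
Proof. by rewrite -coblock_tens_map mxE. Qed.

Lemma tens_map_kron A B : tens_map Phi Omega (kron A B) = kron (Phi A) (Omega B).
Proof.
apply/mxvec_index_matrixP => c u d v; rewrite tens_mapE kronE tkronE.
have -> : slice Omega (kron A B) u v = Omega B u v *: A.
  apply/matrixP => i j; rewrite !mxE.
  have -> : block (kron A B) i j = A i j *: B.
    by apply/matrixP => a b; rewrite !mxE !idx_pairK.
  by rewrite linearZ_LR mxE mulrC.
by rewrite linearZ_LR mxE mulrC.
Qed.

(** Matrix units of the product space are products of matrix units, so product matrices determine a
    linear map. *)
Lemma tens_map_ext (F : {linear 'M[C]_(n * m) -> 'M[C]_(k * l)}) :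
  (forall A B, F (kron A B) = kron (Phi A) (Omega B)) -> tens_map Phi Omega =1 F.
Proof.
move=> h X; rewrite [RHS]lin_delta [LHS]lin_delta; apply: eq_bigr => p _.
apply: eq_bigr => q _; congr (_ *: _).
case/mxvec_indexP: p => i a; case/mxvec_indexP: q => j b.
by rewrite -kron_delta h -tens_map_kron.
Qed.

End Linear.

Lemma block_tens_id {n m l} (Omega : {linear 'M[C]_m -> 'M[C]_l}) (X : 'M[C]_(n * m)) i j :
  block (tens_map (@id 'M[C]_n) Omega X) i j = Omega (block X i j).
Proof.
apply/matrixP => u v; rewrite mxE.
by rewrite (tens_mapE (idfun : {linear 'M[C]_n -> 'M[C]_n}) Omega) /= mxE.
Qed.

(** [completely_positive] only tests identity maps as the first factor; the operator-sum form passes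
    directly to tensor products of two arbitrary maps. *)
Definition kraus {n k} (T : 'M[C]_n -> 'M[C]_k) : Prop :=
  exists N (K : 'I_N -> 'M[C]_(k, n)), forall X, T X = \sum_s K s *m X *m adj (K s).

Lemma cp_kraus {m l} (Omega : {linear 'M[C]_m -> 'M[C]_l}) :
  completely_positive Omega -> kraus Omega.
Proof.
(* The image of w w^* under id (x) Omega is the Choi matrix of Omega. *)
move=> cp; pose w : 'cV[C]_(m * m) := \col_p ((idx_pair p).1 == (idx_pair p).2)%:R.
have /psd_factor[X eX] := cp m _ (psd_gram w).
(* Each column of the factor X of the Choi matrix, reshaped into an l by m matrix, is one Kraus
   operator. *)
exists (m * l)%N, (fun s => \matrix_(a, i) X (mxvec_index i a) s) => Y.
(* As w is the sum of the vectors e_i (x) e_i, the blocks of w w^* are the matrix units, and those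
   of the Choi matrix are their images. *)
have bw i j : block (w *m adj w) i j = delta_mx i j.
  apply/matrixP => a b; rewrite !mxE big_ord1 !mxE !idx_pairK /= conjC_nat -natrM mulnb.
  by rewrite (eq_sym a) (eq_sym b).
have Od i j : Omega (delta_mx i j) = rowblock X i *m adj (rowblock X j).
  by rewrite -bw -block_tens_id eX block_gram.
rewrite lin_delta; apply/matrixP => u v; rewrite !summxE.
transitivity (\sum_i \sum_j \sum_s Y i j * (X (mxvec_index i u) s *
   Num.conj (X (mxvec_index j v) s))).
  apply: eq_bigr => i _; rewrite summxE; apply: eq_bigr => j _.
  rewrite mxE Od mxE mulr_sumr; apply: eq_bigr => s _.
  by rewrite adjE !mxE.
under eq_bigr do rewrite exchange_big.
rewrite exchange_big; apply: eq_bigr => s _; rewrite exchange_big !mxE.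
apply: eq_bigr => j _; rewrite adjE !mxE mulr_suml; apply: eq_bigr => i _.
by rewrite !mxE mulrA (mulrC (Y i j)).
Qed.

Lemma kraus_positive {n k} (T : 'M[C]_n -> 'M[C]_k) : kraus T -> positive_map T.
Proof.
move=> [N [K eT]] X pX; rewrite eT; apply: psd_sum => s; exact: psd_conj.
Qed.

Lemma kraus_id n : kraus (@id 'M[C]_n).
Proof.
by exists 1, (fun=> 1%:M) => X; rewrite big_ord1 adj_scalar1 mulmx1 mul1mx.
Qed.

Lemma tkron_suml {n k m l} (I : finType) (F : I -> 'M[C]_(n, k)) (B : 'M[C]_(m, l)) :
  tkron (\sum_s F s) B = \sum_s tkron (F s) B.
Proof.
by apply/matrixP => p q; rewrite !(mxE, summxE) mulr_suml; apply: eq_bigr => s _; rewrite mxE.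
Qed.

Lemma tkron_sumr {n k m l} (I : finType) (A : 'M[C]_(n, k)) (F : I -> 'M[C]_(m, l)) :
  tkron A (\sum_s F s) = \sum_s tkron A (F s).
Proof.
by apply/matrixP => p q; rewrite !(mxE, summxE) mulr_sumr; apply: eq_bigr => s _; rewrite mxE.
Qed.

Lemma kraus_tens_map {n k m l} (Phi : {linear 'M[C]_n -> 'M[C]_k})
    (Omega : {linear 'M[C]_m -> 'M[C]_l}) :
  kraus Phi -> kraus Omega -> kraus (tens_map Phi Omega).
Proof.
move=> [N [K eK]] [M [L eL]].
pose G s : 'M[C]_(k * l, n * m) := tkron (K (@idx_pair N M s).1) (L (idx_pair s).2).
exists (N * M)%N, G.
(* The operators K_s (x) L_t define a linear map; it is packed as such so that comparison on product
   matrices suffices. *)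
pose F X := \sum_s G s *m X *m adj (G s).
have Flin : linear F.
  move=> a X Y; rewrite /F scaler_sumr -big_split; apply: eq_bigr => s _ /=.
  by rewrite mulmxDr mulmxDl -scalemxAr -scalemxAl.
pose F' := GRing.isLinear.Build C 'M[C]_(n * m) 'M[C]_(k * l) _ F Flin.
pose FL : {linear 'M[C]_(n * m) -> 'M[C]_(k * l)} := HB.pack F F'.
apply: (tens_map_ext (F := FL)) => A B. rewrite eK eL !kronE /FL /= /F tkron_suml.
rewrite [LHS]sum_mxvec_index; apply: eq_bigr => s _; rewrite tkron_sumr.
apply: eq_bigr => t _; rewrite /G idx_pairK /= adj_tkron.
by rewrite !tkronM.
Qed.

(** Exchange of the two tensor factors. It is needed because an iterated product adds its new map on
    the right, while the multiplicativity bound puts the [Cadd] map on the left. *)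
Definition swap {n m} (X : 'M[C]_(n * m)) : 'M[C]_(m * n) :=
  \matrix_(p, q) X (mxvec_index (idx_pair p).2 (idx_pair p).1)
                   (mxvec_index (idx_pair q).2 (idx_pair q).1).

Lemma swapE {n m} (X : 'M[C]_(n * m)) a i b j :
  swap X (mxvec_index a i) (mxvec_index b j) = X (mxvec_index i a) (mxvec_index j b).
Proof. by rewrite mxE !idx_pairK. Qed.

Lemma tens_map_entry {n k m l} (Phi : 'M[C]_n -> 'M[C]_k)
    (Omega : 'M[C]_m -> 'M[C]_l) X c u d v :
  tens_map Phi Omega X (mxvec_index c u) (mxvec_index d v) =
  \sum_(p : 'I_n * 'I_n) \sum_(q : 'I_m * 'I_m)
    X (mxvec_index p.1 q.1) (mxvec_index p.2 q.2) *
    (Phi (delta_mx p.1 p.2) c d * Omega (delta_mx q.1 q.2) u v).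
Proof.
rewrite -(pair_bigA _ (fun i j => \sum_(q : 'I_m * 'I_m)
    X (mxvec_index i q.1) (mxvec_index j q.2) *
    (Phi (delta_mx i j) c d * Omega (delta_mx q.1 q.2) u v))) /=.
rewrite summxE; apply: eq_bigr => i _; rewrite summxE; apply: eq_bigr => j _.
rewrite -(pair_bigA _ (fun a b => X (mxvec_index i a) (mxvec_index j b) *
    (Phi (delta_mx i j) c d * Omega (delta_mx a b) u v))) /=.
rewrite summxE; apply: eq_bigr => a _; rewrite summxE; apply: eq_bigr => b _.
by rewrite !mxE !idx_pairK.
Qed.

Lemma tens_map_swap {n k m l} (Phi : 'M[C]_n -> 'M[C]_k)
    (Omega : 'M[C]_m -> 'M[C]_l) X :
  tens_map Omega Phi (swap X) = swap (tens_map Phi Omega X).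
Proof.
apply/mxvec_index_matrixP => u c v d; rewrite swapE !tens_map_entry exchange_big.
apply: eq_bigr => p _; apply: eq_bigr => q _.
by rewrite swapE; congr (_ * _); rewrite mulrC.
Qed.

Lemma sqn_swap {n m} (X : 'M[C]_(n * m)) : sqn (swap X) = sqn X.
Proof.
rewrite sqn_block sqn_coblock; apply: eq_bigr => a _; apply: eq_bigr => b _.
by congr sqn; apply/matrixP => i j; rewrite !mxE !idx_pairK.
Qed.

Lemma tr_swap {n m} (X : 'M[C]_(n * m)) : \tr (swap X) = \tr X.
Proof.
rewrite /mxtrace !sum_mxvec_index exchange_big; apply: eq_bigr => i _.
by apply: eq_bigr => a _; rewrite swapE.
Qed.

Lemma psd_swap {n m} (X : 'M[C]_(n * m)) : psd X -> psd (swap X).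
Proof.
move=> /psd_factor[Y ->].
pose Z : 'M[C]_(m * n, n * m) := \matrix_(p, q) Y (mxvec_index (idx_pair p).2 (idx_pair p).1) q.
suff -> : swap (Y *m adj Y) = Z *m adj Z by exact: psd_gram.
apply/mxvec_index_matrixP => a i b j; rewrite swapE !mxE; apply: eq_bigr => s _.
by rewrite !mxE !idx_pairK.
Qed.

(** The exchange is an involution preserving positivity, trace and Hilbert-Schmidt norm, so one
    inequality used in both orders gives equality. *)
Lemma norm12_swap {n k m l} (Phi : {linear 'M[C]_n -> 'M[C]_k})
    (Omega : {linear 'M[C]_m -> 'M[C]_l}) :
  norm12 (tens_map Omega Phi) = norm12 (tens_map Phi Omega).
Proof.
have swapK p q (X : 'M[C]_(p * q)) : swap (swap X) = X.
  by apply/mxvec_index_matrixP => i a j b; rewrite !swapE.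
have half n' k' m' l' (P : {linear 'M[C]_n' -> 'M[C]_k'}) 
     (O : {linear 'M[C]_m' -> 'M[C]_l'}) :
  norm12 (tens_map O P) <= norm12 (tens_map P O).
  apply: norm12_le; first exact: norm12_ge0.
  move=> X pX; rewrite -(swapK _ _ X) /= tens_map_swap tr_swap hsnormE sqn_swap -hsnormE.
  exact/(hsnorm_le_norm12 (tens_map P O))/psd_swap.
by apply/eqP; rewrite eq_le !half.
Qed.

End Tensor.

(** * The largest eigenvalue of a real symmetric matrix *)

Section SymmetricForms.
Variable R : realType.
Local Notation C := R[i].
Local Notation toC := (map_mx (real_complex R)).

Lemma adj_real {p q} (A : 'M[R]_(p, q)) : adj (toC A) = toC (A^T).
Proof. by apply/matrixP => i j; rewrite !mxE; exact: conj_real. Qed.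

Section Spectrum.
Variables (d : nat) (A : 'M[R]_d) (P : 'M[C]_d) (e : 'I_d -> R).
Hypotheses (PP1 : adj P *m P = 1%:M) (PP2 : P *m adj P = 1%:M)
           (eA : toC A = adj P *m diag_mx (\row_i (e i)%:C%C) *m P).

(** Diagonalisation takes place over the complex numbers, so a real vector gets complex coordinates,
    and the real form is a sum of their squared moduli weighted by the eigenvalues. *)
Lemma form_spectral (c : 'rV[R]_d) :
  (c *m A *m c^T) 0 0 = \sum_i e i * sqc ((toC c *m adj P) 0 i) /\
  (c *m c^T) 0 0 = \sum_i sqc ((toC c *m adj P) 0 i).
Proof.
set w := toC c *m adj P; split.
  rewrite -[LHS]toR_real; have -> : ((c *m A *m c^T) 0 0)%:C%C =
      (toC c *m toC A *m adj (toC c)) 0 0.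
    by rewrite adj_real -!map_mxM [RHS]mxE.
  have -> : toC c *m toC A *m adj (toC c) =
      w *m diag_mx (\row_i (e i)%:C%C) *m adj w.
    by rewrite eA /w adjM adjK !mulmxA.
  rewrite mxE toR_sum; apply: eq_bigr => i _.
  by rewrite mul_mx_diag !mxE -/w mulrAC mulrC toRMreal.
rewrite -[LHS]toR_real; have -> : ((c *m c^T) 0 0)%:C%C =
      (toC c *m adj (toC c)) 0 0.
  by rewrite adj_real -!map_mxM [RHS]mxE.
have -> : toC c *m adj (toC c) = w *m adj w.
  by rewrite /w adjM adjK !mulmxA -(mulmxA (toC c)) PP1 mulmx1.
by rewrite mxE toR_sum; apply: eq_bigr => i _; rewrite !mxE.
Qed.

(** A row of P is only a complex eigenvector. The characteristic polynomial commutes with extension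
    of scalars, so the real number [e i] is already a root over the reals. *)
Lemma spectral_eigenvalue i : eigenvalue A (e i).
Proof.
rewrite eigenvalue_root_char -(fmorph_root (real_complex R)) map_char_poly.
rewrite -eigenvalue_root_char; apply/eigenvalueP; exists (row i P).
  rewrite eA rowE !mulmxA -(mulmxA _ P) PP2 mulmx1 -[delta_mx _ _ *m diag_mx _]rowE row_diag_mx mxE.
  by rewrite -scalemxAl -rowE.
apply/eqP => r0; have := congr1 (fun Z : 'M_d => Z i i) PP2.
have -> : (P *m adj P) i i = (row i P *m adj P) 0 i by rewrite -row_mul [RHS]mxE.
by rewrite r0 mul0mx !mxE eqxx => /eqP; rewrite eq_sym oner_eq0.
Qed.

End Spectrum.

Lemma sum_sqr_pos {d} (v : 'rV[R]_d) : v != 0 -> 0 < (v *m v^T) 0 0.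
Proof.
have e : (v *m v^T) 0 0 = \sum_i v 0 i ^+ 2.
  by rewrite mxE; apply: eq_bigr => i _; rewrite mxE.
rewrite e => v0; rewrite lt_def sumr_ge0 ?andbT; last by move=> i _; exact: sqr_ge0.
apply: contra_neq v0 => /eqP; rewrite psumr_eq0; last by move=> i _; exact: sqr_ge0.
move=> /allP h; apply/rowP => i; rewrite mxE; apply/eqP; rewrite -sqrf_eq0.
by apply: (h i); rewrite mem_index_enum.
Qed.

Lemma lambda_max_form {d} (A : 'M[R]_d) (c : 'rV[R]_d) : A^T = A ->
  (c *m A *m c^T) 0 0 <= lambda_max A * (c *m c^T) 0 0.
Proof.
move=> sA; have hA : herm (toC A) by rewrite /herm adj_real sA.
have [P [e [PP1 PP2 eA _]]] := herm_spectral hA.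
(* The supremum bounds the eigenvalues only if their set is bounded; evaluating the form at an
   eigenvector bounds each of them by the sum of the |e_i|. *)
have bA : has_ubound [set a : R | eigenvalue A a]%classic.
  exists (\sum_i `|e i|) => a /= /eigenvalueP[v va v0].
  have [f1 f2] := form_spectral PP1 eA v.
  rewrite -(ler_pM2r (sum_sqr_pos v0)); have -> : a * (v *m v^T) 0 0 = (v *m A *m v^T) 0 0.
    by rewrite va -scalemxAl [RHS]mxE.
  rewrite f1 f2 mulr_sumr; apply: ler_sum => i _; rewrite ler_wpM2r ?sqc_ge0 //.
  apply: le_trans (ler_norm _) _; rewrite (bigD1 i) //= lerDl.
  by apply: sumr_ge0 => j _.
have [-> ->] := form_spectral PP1 eA c.
rewrite mulr_sumr; apply: ler_sum => i _; rewrite ler_wpM2r ?sqc_ge0 //.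
apply: ub_le_sup => //=; exact: spectral_eigenvalue PP2 eA i.
Qed.

Lemma lambda_max_ge0 {d} (A : 'M[R]_d) : A^T = A ->
  (forall c : 'rV_d, 0 <= (c *m A *m c^T) 0 0) -> 0 <= lambda_max A.
Proof.
case: d A => [|d] A sA pA.
  (* Size 0 occurs for n = 1: there are no eigenvalues, and the supremum of the empty set is 0. *)
  rewrite /lambda_max (_ : [set a : R | eigenvalue A a]%classic = set0) ?sup0 //.
  apply/seteqP; split => // a /= /eigenvalueP[v _ /eqP[]].
  by apply/rowP => -[].
have v0 : (delta_mx 0 ord0 : 'rV[R]_d.+1) != 0.
  by apply/eqP => /rowP/(_ ord0); rewrite !mxE eqxx => /eqP; rewrite oner_eq0.
rewrite -(pmulr_lge0 _ (sum_sqr_pos v0)).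
exact: le_trans (pA _) (lambda_max_form _ sA).
Qed.
End SymmetricForms.

(** * Real coordinates of traceless Hermitian matrices *)

Section TracelessBasis.
Variable R : realType.
Local Notation C := R[i].

Lemma mxvec_dot {p q} (A B : 'M[C]_(p, q)) :
  mxvec A *m adj (mxvec B) = (\tr (A *m adj B))%:M.
Proof.
apply/matrixP => i j; rewrite !ord1 !mxE eqxx mulr1n sum_mxvec_index.
apply: eq_bigr => a _; rewrite mxE; apply: eq_bigr => b _.
by rewrite !adjE !mxvecE.
Qed.

Lemma rdot_herm {n} (X Y : 'M[C]_n) : herm Y -> rdot X Y = toR (\tr (X *m Y)).
Proof. by rewrite /rdot => ->. Qed.

Lemma herm_tr_real {n} (X : 'M[C]_n) : herm X -> \tr X = (toR (\tr X))%:C%C.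
Proof.
move=> hX; have := tr_adj X; rewrite hX => e.
by rewrite /toR RRe_real //; apply/CrealP.
Qed.

Lemma herm_trM_real {n} (X Y : 'M[C]_n) : herm X -> herm Y ->
  \tr (X *m Y) = (toR (\tr (X *m Y)))%:C%C.
Proof.
move=> hX hY; have := tr_adj (X *m Y); rewrite adjM hX hY mxtrace_mulC => e.
by rewrite /toR RRe_real //; apply/CrealP.
Qed.

Lemma traceless_expand {n} (M : 'I_(n ^ 2 - 1) -> 'M[C]_n) X : (0 < n)%N ->
  onb_traceless M -> herm X -> \tr X = 0 ->
  exists c : 'rV[R]_(n ^ 2 - 1), X = \sum_i (c 0 i)%:C%C *: M i.
Proof.
move=> n0 [hM oM] hX tX.
(* The n^2 rows of U are the identity and the M i; the explicit right inverse W
   shows that they are linearly independent, hence span all matrices. *)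
pose V : 'M[C]_(n ^ 2 - 1, n * n) := \matrix_i mxvec (M i).
pose U := col_mx (mxvec (1%:M : 'M[C]_n)) V.
pose W := row_mx (n%:R^-1 *: adj (mxvec (1%:M : 'M[C]_n))) (adj V).
have nC : (n%:R : C) != 0 by rewrite pnatr_eq0 -lt0n.
have UW : U *m W = 1%:M.
  have rV i j : (V *m adj (mxvec (1%:M : 'M[C]_n))) i j = 0.
    rewrite -[LHS](_ : (row i (V *m adj (mxvec 1%:M))) 0 j = _); last by rewrite mxE.
    by rewrite row_mul rowK mxvec_dot adj_scalar1 mulmx1 (hM i).2 !mxE mul0rn.
  rewrite mul_col_row -scalemxAr mxvec_dot adj_scalar1 mulmx1 mxtrace1.
  rewrite -scalemxAr (_ : V *m adj (mxvec 1%:M) = 0); last first.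
    by apply/matrixP => i j; rewrite rV mxE.
  rewrite scaler0 (_ : mxvec 1%:M *m adj V = 0); last first.
    apply/matrixP => j i; rewrite -[mxvec _]adjK -adjM adjE rV mxE.
    by rewrite conjC0.
  rewrite (_ : V *m adj V = 1%:M); last first.
    apply/matrixP => i j; transitivity (\tr (M i *m M j)); last by rewrite oM mxE.
    rewrite -[in RHS](hM j).1; have := congr1 (fun Z : 'M[C]_1 => Z 0 0) (mxvec_dot (M i) (M j)).
    rewrite !mxE eqxx mulr1n => <-; apply: eq_bigr => s _.
    by rewrite !mxE.
  by rewrite scale_scalar_mx mulVf // -scalar_mx_block.
have fU : row_full U.
  rewrite /row_full; have /eqP -> : row_free U by apply/row_freeP; exists W.
  (* Truncated subtraction makes 1 + (n^2 - 1) equal to n * n only for positive n. *)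
  by rewrite add1n subn1 prednK ?expn_gt0 ?n0 // mulnn.
have /submxP[D] := submx_full (mxvec X) fU.
rewrite -[D]hsubmxK mul_row_col => eX.
have {}eX : X = (lsubmx D) 0 0 *: 1%:M + \sum_i (rsubmx D) 0 i *: M i.
  rewrite -[LHS]mxvecK eX linearD /=; congr (_ + _).
    by rewrite [lsubmx D in LHS]mx11_scalar mul_scalar_mx linearZ /= mxvecK.
  rewrite mulmx_sum_row linear_sum; apply: eq_bigr => i _.
  by rewrite linearZ_LR /= rowK mxvecK.
(* Each M_i is traceless, so the trace of X is n times the coefficient of the identity. *)
have D0 : (lsubmx D) 0 0 = 0.
  move: tX; rewrite eX mxtraceD mxtraceZ mxtrace1 raddf_sum big1 /=; last first.
    by move=> i _; rewrite mxtraceZ (hM i).2 mulr0.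
  by rewrite addr0 => /eqP; rewrite mulf_eq0 (negbTE nC) orbF => /eqP.
rewrite D0 scale0r add0r in eX.
(* Pairing with M_j identifies the coefficient as tr (X M_j), which is real since both matrices are
   Hermitian. *)
have cE j : (rsubmx D) 0 j = \tr (X *m M j).
  rewrite eX mulmx_suml raddf_sum (bigD1 j) //= -scalemxAl mxtraceZ oM eqxx mulr1.
  rewrite big1 ?addr0 // => i /negbTE ij.
  by rewrite -scalemxAl mxtraceZ oM ij mulr0.
exists (\row_j toR (\tr (X *m M j))); rewrite {1}eX; apply: eq_bigr => j _.
by rewrite cE mxE -herm_trM_real //; case: (hM j).
Qed.

End TracelessBasis.

(** * Multiplicativity *)

Section SingleMap.
Variable R : realType.
Local Notation C := R[i].

(** Pythagoras: the identity is orthogonal to traceless matrices and has squared norm k. *)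
Lemma sqn_traceless_shift {k} (Z : 'M[C]_k) (a : R) : \tr Z = 0 ->
  sqn (Z + a%:C%C *: 1%:M) = sqn Z + a ^+ 2 * k%:R.
Proof.
move=> tZ; rewrite /sqn rdotDl !rdotDr !rdotZl !rdotZr (rdotC 1%:M Z).
rewrite /rdot !adj_scalar1 mulmx1 tZ mulmx1 mxtrace1.
have -> : toR (k%:R : C) = k%:R by rewrite -(rmorph_nat (real_complex R)).
by rewrite /toR /=; ring.
Qed.

(** The Cartesian decomposition carries statements about Hermitian matrices over to all complex
    ones, such as the slices of a Hermitian matrix. *)
Lemma herm_parts {n} (X : 'M[C]_n) :
  exists X1 X2, [/\ herm X1, herm X2 & X = X1 + 'i%C *: X2].
Proof.
have two : (2 : C) != 0 by rewrite pnatr_eq0.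
have c2 : Num.conj (2^-1 : C) = 2^-1 by rewrite fmorphV rmorph_nat.
have ii : 'i%C * 'i%C = -1 :> C by rewrite -expr2 sqr_i.
have ci : Num.conj ('i%C : C) = - 'i%C by rewrite complexiE conjCi.
exists (2^-1 *: (X + adj X)), (- ('i%C / 2) *: (X - adj X)); split.
- by rewrite /herm adj_scale adjD adjK c2 addrC.
- rewrite /herm adj_scale adjB adjK rmorphN rmorphM /= c2 [X in - (X * _)]ci.
  by rewrite mulNr opprK -[in RHS]opprB scaleNr scalerN opprK.
- rewrite scalerA mulrN mulrA ii mulN1r opprK -scalerDr addrACA subrr addr0.
  by rewrite scalerDr -scalerDl -mulr2n -[2^-1 *+ 2]mulr_natr mulVf // scale1r.
Qed.

Lemma sqn_herm_parts {n} (X Y : 'M[C]_n) : herm X -> herm Y ->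
  sqn (X + 'i%C *: Y) = sqn X + sqn Y.
Proof.
move=> hX hY; have ci : Num.conj ('i%C : C) = - 'i%C by rewrite complexiE conjCi.
(* The inner product of X and iY is -i tr (XY) with tr (XY) real, so its real part vanishes. *)
have e : rdot X ('i%C *: Y) = 0.
  rewrite /rdot adj_scale hY -scalemxAr mxtraceZ herm_trM_real // [X in toR (X * _)]ci.
  by rewrite /toR /=; ring.
rewrite {1}/sqn rdotDl !rdotDr (rdotC _ X) e -/(sqn X) -/(sqn _) sqnZ.
have -> : sqc ('i%C : C) = 1 by rewrite /sqc toRM_conj /=; ring.
by ring.
Qed.

Lemma sqc_re_im (a b : R) : sqc (a%:C%C + 'i%C * b%:C%C) = a ^+ 2 + b ^+ 2.
Proof. by rewrite /sqc toRM_conj /=; ring. Qed.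

Section Bound.
Variables (n k : nat) (Phi : {linear 'M[C]_n -> 'M[C]_k}).
Variable M : 'I_(n ^ 2 - 1) -> 'M[C]_n.
Hypotheses (n0 : (0 < n)%N) (k0 : (0 < k)%N) (hP : herm_preserving Phi)
  (uP : unital Phi) (tP : trace_preserving Phi) (oM : onb_traceless M).
Local Notation lam := (lambda_max (A_mat Phi M)).

Lemma A_mat_form (c : 'rV[R]_(n ^ 2 - 1)) :
  (c *m A_mat Phi M *m c^T) 0 0 = sqn (Phi (\sum_i (c 0 i)%:C%C *: M i)).
Proof.
rewrite mxE linear_sum /sqn rdot_sumr; apply: eq_bigr => j _.
rewrite mxE mulr_suml rdot_suml; apply: eq_bigr => i _.
rewrite !linearZ_LR rdotZl rdotZr rdot_herm ?mxE; last by apply: hP; case: (oM.1 j).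
by ring.
Qed.

Lemma A_mat_sym : (A_mat Phi M)^T = A_mat Phi M.
Proof. by apply/matrixP => i j; rewrite !mxE mxtrace_mulC. Qed.

Lemma lam_ge0 : 0 <= lam.
Proof.
by apply: lambda_max_ge0 A_mat_sym _ => c; rewrite A_mat_form sqn_ge0.
Qed.

Lemma onb_sqn (c : 'rV[R]_(n ^ 2 - 1)) :
  sqn (\sum_i (c 0 i)%:C%C *: M i) = (c *m c^T) 0 0.
Proof.
rewrite mxE /sqn rdot_sumr; apply: eq_bigr => j _.
rewrite mxE rdot_suml (bigD1 j) //= big1 => [|i /negbTE ij].
  rewrite rdotZl rdotZr rdot_herm; last exact: (oM.1 j).1.
  rewrite oM.2 eqxx addr0.
  by rewrite (toR_real 1); ring.
rewrite rdotZl rdotZr rdot_herm; last exact: (oM.1 j).1.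
  rewrite oM.2 ij.
by rewrite (toR_real 0); ring.
Qed.

Lemma traceless_bound X : herm X -> \tr X = 0 -> sqn (Phi X) <= lam * sqn X.
Proof.
move=> hX tX; have [c ->] := traceless_expand n0 oM hX tX.
rewrite -A_mat_form onb_sqn; exact/lambda_max_form/A_mat_sym.
Qed.

(** Write X = X_0 + (t/n) I with X_0 traceless. Since Phi I = (n/k) I and Phi X_0 is traceless,
    |X|^2 = |X_0|^2 + t^2/n and |Phi X|^2 = |Phi X_0|^2 + t^2/k. Eliminating |X_0|^2 from |Phi
    X_0|^2 <= lam |X_0|^2 produces the coefficient 1/k - lam/n. *)
Lemma herm_bound X : herm X ->
  sqn (Phi X) <= (k%:R^-1 - lam / n%:R) * toR (\tr X) ^+ 2 + lam * sqn X.
Proof.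
move=> hX; set t := toR (\tr X).
have nR : (n%:R : R) != 0 by rewrite pnatr_eq0 -lt0n.
have kR : (k%:R : R) != 0 by rewrite pnatr_eq0 -lt0n.
have nC : (n%:R : C) != 0 by rewrite pnatr_eq0 -lt0n.
pose X0 := X - (t / n%:R)%:C%C *: 1%:M.
have natC q : (q%:R : R)%:C%C = q%:R :> C by exact: (rmorph_nat (real_complex R)).
have eX : X = X0 + (t / n%:R)%:C%C *: 1%:M by rewrite /X0 subrK.
have hX0 : herm X0 by rewrite /herm /X0 adjB adj_scale hX adj_scalar1 conj_real.
have tX0 : \tr X0 = 0.
  rewrite /X0 raddfB /= mxtraceZ mxtrace1 (herm_tr_real hX) -/t.
  by rewrite -natC -rmorphM divfK // subrr.
have P1 : Phi 1%:M = (n%:R / k%:R) *: 1%:M.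
  have {1}-> : 1%:M = n%:R *: (n%:R^-1 *: 1%:M) :> 'M[C]_n.
    by rewrite scalerA mulfV // scale1r.
  by rewrite linearZ_LR uP scalerA.
have ePX : Phi X = Phi X0 + (t / k%:R)%:C%C *: 1%:M.
  rewrite {1}eX linearD linearZ_LR P1 scalerA; congr (_ + _ *: _).
  by rewrite -!natC -fmorphV -!rmorphM; congr (_%:C%C); field; rewrite nR kR.
have eP : sqn (Phi X) = sqn (Phi X0) + (t / k%:R) ^+ 2 * k%:R.
  by rewrite ePX sqn_traceless_shift // tP // tX0.
have eQ : sqn X = sqn X0 + (t / n%:R) ^+ 2 * n%:R.
  by rewrite {1}eX sqn_traceless_shift.
have := traceless_bound hX0 tX0; rewrite eP eQ => h.
rewrite -subr_ge0 in h; rewrite -subr_ge0; apply: le_trans h _.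
by rewrite le_eqVlt; apply/orP; left; apply/eqP; field; rewrite nR kR.
Qed.

(** All three quadratic terms are additive over the two Hermitian parts, so the Hermitian bounds add
    up. *)
Lemma sqn_bound X :
  sqn (Phi X) <= (k%:R^-1 - lam / n%:R) * sqc (\tr X) + lam * sqn X.
Proof.
have [X1 [X2 [h1 h2 ->]]] := herm_parts X.
rewrite linearD linearZ_LR !sqn_herm_parts //; try exact: hP.
rewrite mxtraceD mxtraceZ (herm_tr_real h1) (herm_tr_real h2) sqc_re_im.
have := lerD (herm_bound h1) (herm_bound h2).
by rewrite !mulrDr addrACA.
Qed.

Section Tens.
Variables (m l : nat) (Omega : {linear 'M[C]_m -> 'M[C]_l}).

(** This turns the trace terms, summed over all slices, into the squared norm of [Omega] at the
    partial trace. *)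
Lemma tr_slice (X : 'M[C]_(n * m)) u v :
  \tr (slice Omega X u v) = Omega (ptrace X) u v.
Proof.
rewrite linear_sum summxE; apply: eq_bigr => i _.
by rewrite mxE.
Qed.

Lemma sqn_tens_bound (X : 'M[C]_(n * m)) : sqn (tens_map Phi Omega X) <=
  (k%:R^-1 - lam / n%:R) * sqn (Omega (ptrace X)) +
  lam * sqn (tens_map (@id 'M[C]_n) Omega X).
Proof.
rewrite sqn_coblock [sqn (Omega _)]sqnE (sqn_coblock (tens_map _ Omega X)).
rewrite !mulr_sumr -big_split; apply: ler_sum => u _ /=.
rewrite !mulr_sumr -big_split; apply: ler_sum => v _ /=.
rewrite coblock_tens_map (coblock_tens_map (idfun : {linear 'M[C]_n -> 'M[C]_n}) Omega).
by rewrite -tr_slice; exact: sqn_bound.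
Qed.

Lemma hsnorm_tens_id (X : 'M[C]_(n * m)) : kraus Omega -> psd X ->
  hsnorm (tens_map (@id 'M[C]_n) Omega X) <= norm12 Omega * toR (\tr X).
Proof.
move=> kO pX.
have pT : psd (tens_map (@id 'M[C]_n) Omega X).
  have kT := kraus_tens_map (Phi := (idfun : {linear 'M[C]_n -> 'M[C]_n})) (kraus_id R n) kO.
  exact: (kraus_positive kT pX).
apply: le_trans (hsnorm_psd_block pT) _.
rewrite -tr_ptrace raddf_sum toR_sum mulr_sumr; apply: ler_sum => i _ /=.
by rewrite block_tens_id hsnorm_le_norm12 //; exact: psd_block.
Qed.

Lemma sqn_tens_gamma (X : 'M[C]_(n * m)) : kraus Omega -> psd X ->
  sqn (tens_map Phi Omega X) <= gamma Phi M * (norm12 Omega * toR (\tr X)) ^+ 2.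
Proof.
move=> kO pX; apply: le_trans (sqn_tens_bound X) _.
set c := norm12 Omega * _.
have pt : psd (ptrace X) by exact: psd_ptrace.
have c0 : 0 <= c by rewrite mulr_ge0 ?norm12_ge0 // (psd_tr pX).2.
have h1 : sqn (Omega (ptrace X)) <= c ^+ 2.
  rewrite -sqr_hsnorm ler_pXn2r ?nnegrE ?hsnorm_ge0 //.
  by rewrite /c -tr_ptrace hsnorm_le_norm12.
have h2 : sqn (tens_map (@id 'M[C]_n) Omega X) <= c ^+ 2.
  by rewrite -sqr_hsnorm ler_pXn2r ?nnegrE ?hsnorm_ge0 // hsnorm_tens_id.
have l0 := lam_ge0; have L2 := ler_wpM2l l0 h2.
have nR : (0 : R) < n%:R by rewrite ltr0n.
have kR : (0 : R) < k%:R by rewrite ltr0n.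
rewrite /gamma; case: ifPn => cas.
  (* Both terms are at most their coefficient times c^2, and 1/k - lam/n + lam is the first value of
     [gamma]. *)
  have cf : 0 <= k%:R^-1 - lam / n%:R.
    by rewrite subr_ge0 ler_pdivrMr // mulrC ler_pdivlMr // mulrC.
  apply: le_trans (lerD (ler_wpM2l cf h1) L2) _.
  by rewrite le_eqVlt; apply/orP; left; apply/eqP; ring.
(* Here the first term is nonpositive and is dropped, which leaves lam, the second value of
   [gamma]. *)
have cf : k%:R^-1 - lam / n%:R <= 0.
  rewrite subr_le0 ler_pdivlMr // mulrC ler_pdivrMr // mulrC.
  by rewrite -ltNge in cas; exact: ltW.
by apply: le_trans L2; rewrite gerDr mulr_le0_ge0 // sqn_ge0.
Qed.

End Tens.
End Bound.

(** Product inputs factor both norms. The suprema are reached one factor at a time: dividing by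
    |Omega B| bounds [norm12 Phi], then dividing by [norm12 Phi] bounds [norm12 Omega]; a zero
    divisor makes the claim trivial. *)
Lemma norm12_tens_ge {n k m l} (Phi : {linear 'M[C]_n -> 'M[C]_k})
    (Omega : {linear 'M[C]_m -> 'M[C]_l}) :
  norm12 Phi * norm12 Omega <= norm12 (tens_map Phi Omega).
Proof.
set N := norm12 (tens_map _ _); have N0 : 0 <= N by exact: norm12_ge0.
have h A B : psd A -> psd B ->
    hsnorm (Phi A) * hsnorm (Omega B) <= N * toR (\tr A) * toR (\tr B).
  move=> pA pB; rewrite -hsnorm_kron -tens_map_kron.
  have := hsnorm_le_norm12 (tens_map Phi Omega) (psd_kron pA pB).
  rewrite tr_kron (psd_tr pA).1 toRMreal -/N mulrA; exact.
have h2 B : psd B -> norm12 Phi * hsnorm (Omega B) <= N * toR (\tr B).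
  move=> pB; have := hsnorm_ge0 (Omega B); rewrite le_eqVlt => /orP[/eqP <-|p].
    by rewrite mulr0 mulr_ge0 // (psd_tr pB).2.
  rewrite -ler_pdivlMr //; apply: norm12_le.
    by rewrite divr_ge0 ?hsnorm_ge0 // mulr_ge0 // (psd_tr pB).2.
  move=> A pA; rewrite mulrAC ler_pdivlMr // mulrAC; exact: h.
have := norm12_ge0 Phi; rewrite le_eqVlt => /orP[/eqP <-|p]; first by rewrite mul0r.
rewrite mulrC -ler_pdivlMr //; apply: norm12_le; first by rewrite divr_ge0 ?norm12_ge0.
by move=> B pB; rewrite mulrAC ler_pdivlMr // mulrC h2.
Qed.

Lemma norm12_tens {n k m l} (Phi : {linear 'M[C]_n -> 'M[C]_k})
    (Omega : {linear 'M[C]_m -> 'M[C]_l}) :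
  (0 < n)%N -> (0 < k)%N ->
  herm_preserving Phi -> unital Phi -> trace_preserving Phi -> Cadd Phi ->
  kraus Omega -> norm12 (tens_map Phi Omega) = norm12 Phi * norm12 Omega.
Proof.
move=> n0 k0 hP uP tP [M [oM gM]] kO; apply/eqP; rewrite eq_le norm12_tens_ge andbT.
apply: norm12_le => [|X pX]; first by rewrite mulr_ge0 ?norm12_ge0.
have t0 := (psd_tr pX).2.
rewrite -(@ler_pXn2r _ 2) ?nnegrE ?hsnorm_ge0 ?mulr_ge0 ?norm12_ge0 //.
rewrite sqr_hsnorm -mulrA exprMn -gM; exact: sqn_tens_gamma.
Qed.

End SingleMap.

(** * Minimal output entropy *)

Section Channels.
Variable R : realType.
Local Notation C := R[i].

Definition kraus_channel {n k} (T : 'M[C]_n -> 'M[C]_k) : Prop :=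
  kraus T /\ trace_preserving T.

Lemma tp_tr {n k} (T : {linear 'M[C]_n -> 'M[C]_k}) X :
  trace_preserving T -> \tr (T X) = \tr X.
Proof.
move=> tT; have [X1 [X2 [h1 h2 ->]]] := herm_parts X.
by rewrite linearD linearZ_LR !mxtraceD !mxtraceZ !tT.
Qed.

Lemma kraus_channel_tens {n k m l} (Phi : {linear 'M[C]_n -> 'M[C]_k})
    (Omega : {linear 'M[C]_m -> 'M[C]_l}) :
  kraus_channel Phi -> kraus_channel Omega -> kraus_channel (tens_map Phi Omega).
Proof.
move=> [kP tP] [kO tO]; split; first exact: kraus_tens_map.
(* The trace is summed over diagonal coblocks: [Phi] preserves the trace of each slice, and what
   remains is the trace of [Omega] at the partial trace. *)
move=> X _; transitivity (\sum_u \tr (coblock (tens_map Phi Omega X) u u)).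
  rewrite [LHS]sum_mxvec_index exchange_big; apply: eq_bigr => u _.
  by apply: eq_bigr => i _; rewrite mxE.
under eq_bigr do rewrite coblock_tens_map (tp_tr _ tP) tr_slice.
by rewrite -[LHS]/(\tr (Omega (ptrace X))) (tp_tr _ tO) tr_ptrace.
Qed.

Lemma density_exists n : (0 < n)%N -> exists rho : 'M[C]_n, density rho.
Proof.
case: n => // n _; exists (delta_mx ord0 0 *m adj (delta_mx ord0 (0 : 'I_1))).
split; first exact: psd_gram.
rewrite mxtrace_mulC /mxtrace big_ord1 mxE (bigD1 ord0) //= big1 => [|j ji].
  by rewrite adjE !mxE !eqxx conjC1 mulr1 addr0.
by rewrite adjE !mxE (negbTE ji) mulr0.
Qed.

Section Entropy.
Variables (n k : nat) (T : {linear 'M[C]_n -> 'M[C]_k}).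

Lemma norm12_le_density (c : R) : 0 <= c ->
  (forall rho, density rho -> hsnorm (T rho) <= c) -> norm12 T <= c.
Proof.
move=> c0 h; apply: norm12_le => // P pP.
have [etr t0] := psd_tr pP; set t := toR _ in etr t0 *.
have [tz|tz] := eqVneq t 0.
  by rewrite (psd_tr_eq0 pP tz) linear0 hsnorm0 mulr_ge0.
have dP : density ((t^-1)%:C%C *: P).
  split; last by rewrite mxtraceZ etr -rmorphM mulVf.
  split; first by rewrite /herm adj_scale conj_real pP.1.
  move=> v; rewrite -scalemxAr -scalemxAl mxE mulr_ge0 //; last exact: pP.2.
  by rewrite ler0c invr_ge0.
have := h _ dP; rewrite linearZ_LR hsnormZ /sqc conj_real -rmorphM toR_real -expr2.
by rewrite sqrtr_sqr ger0_norm ?invr_ge0 // mulrC ler_pdivrMr // lt_def tz.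
Qed.

Hypotheses (n0 : (0 < n)%N) (chT : kraus_channel T).

(** Strict positivity, which follows from the output having trace 1, keeps the logarithm away from
    its default values. *)
Lemma S2_channel rho : density rho ->
  [/\ S2 (T rho) = - ln (sqn (T rho)), 0 < sqn (T rho) & sqn (T rho) <= norm12 T ^+ 2].
Proof.
move=> [pr tr1]; have pT := kraus_positive chT.1 pr; split.
- by rewrite /S2 /sqn rdot_herm //; exact: pT.1.
- rewrite lt_def sqn_ge0 andbT; apply/eqP => /sqn_eq0 T0.
  have := tp_tr rho chT.2; rewrite T0 mxtrace0 tr1 => /esym/eqP.
  by rewrite oner_eq0.
- rewrite -sqr_hsnorm ler_pXn2r ?nnegrE ?hsnorm_ge0 ?norm12_ge0 //.
  by have := hsnorm_le_norm12 T pr; rewrite tr1 mulr1.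
Qed.

Lemma norm12_gt0 : 0 < norm12 T.
Proof.
have [rho dr] := density_exists n0; have [_ p le] := S2_channel dr.
rewrite lt_def norm12_ge0 andbT; apply/eqP => z.
by move: (lt_le_trans p le); rewrite z expr0n ltxx.
Qed.

Lemma Smin2_norm12 : Smin2 T = - ln (norm12 T ^+ 2).
Proof.
have Np : 0 < norm12 T ^+ 2 by rewrite exprn_gt0 // norm12_gt0.
rewrite /Smin2; set S := (X in inf X).
have [rho0 dr0] := density_exists n0.
have lb : lbound S (- ln (norm12 T ^+ 2)).
  move=> _ [rho dr <-]; have [-> p le] := S2_channel dr.
  by rewrite lerN2 ler_ln.
have Sne : (S !=set0)%classic by exists (S2 (T rho0)), rho0.
apply/eqP; rewrite eq_le lb_le_inf // andbT.
set b := inf S.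
have bS : lbound S b by apply: ge_inf; exists (- ln (norm12 T ^+ 2)).
(* The infimum b gives |T rho|^2 <= exp (- b) for every density matrix; hence the square root of exp
   (- b) bounds the norm. *)
rewrite lerNr -[X in _ <= X]expRK ler_ln ?posrE ?expR_gt0 //.
have e0 := expR_ge0 (- b).
rewrite -(sqr_sqrtr e0) ler_pXn2r ?nnegrE ?norm12_ge0 ?sqrtr_ge0 //.
apply: norm12_le_density => [|rho dr]; first exact: sqrtr_ge0.
have [eS p _] := S2_channel dr.
rewrite hsnormE ler_wsqrtr // -[X in X <= _]lnK ?posrE // ler_expR lerNr -eS.
by apply: bS; exists rho.
Qed.

End Entropy.

Lemma Smin2_tens {n k m l} (Phi : {linear 'M[C]_n -> 'M[C]_k})
    (Omega : {linear 'M[C]_m -> 'M[C]_l}) :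
  (0 < n)%N -> (0 < m)%N -> kraus_channel Phi -> kraus_channel Omega ->
  norm12 (tens_map Phi Omega) = norm12 Phi * norm12 Omega ->
  Smin2 (tens_map Phi Omega) = Smin2 Phi + Smin2 Omega.
Proof.
move=> n0 m0 cP cO e; rewrite !Smin2_norm12 ?muln_gt0 ?n0 //; last exact: kraus_channel_tens.
by rewrite e exprMn lnM ?opprD // posrE exprn_gt0 // norm12_gt0.
Qed.

Lemma norm12_id1 : norm12 (fun X : 'M[C]_1 => X) = 1.
Proof.
pose T : {linear 'M[C]_1 -> 'M[C]_1} := idfun.
apply/eqP; rewrite eq_le; apply/andP; split.
  apply: (norm12_le (T := T)) => // P pP.
  by rewrite mul1r; exact: hsnorm_psd_tr.
have [rho [pr t1]] := density_exists (ltnSn 0).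
have := hsnorm_le_norm12 T pr; rewrite t1 mulr1; apply: le_trans.
rewrite /T /= hsnormE sqnE !big_ord1 (_ : rho 0 0 = 1); last first.
  by rewrite -t1 /mxtrace big_ord1.
by rewrite /sqc toRM_conj /= mul0r addr0 mulr1 sqrtr1.
Qed.

(** * Induction over finite tensor products *)

Section Family.
Variables (ns ks : nat -> nat) (Phis : forall i, {linear 'M[C]_(ns i) -> 'M[C]_(ks i)}).
Local Notation T := (tens_fam (fun i => Phis i)).

Lemma tens_fam_is_linear N : linear (T N).
Proof. by case: N => [//|N]; exact: tens_map_is_linear. Qed.

HB.instance Definition _ N := GRing.isLinear.Build C 'M[C]_(pdim ns N)
  'M[C]_(pdim ks N) _ (T N) (@tens_fam_is_linear N).

(** Positive dimension and the Kraus channel property are carried along because the next step uses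
    the partial product in the role of [Omega]. *)
Lemma tens_fam_multiplicative N : (forall i, (i < N)%N ->
    [/\ (0 < ns i)%N /\ (0 < ks i)%N, herm_preserving (Phis i),
        quantum_channel (Phis i), unital (Phis i) & Cadd (Phis i)]) ->
  [/\ (0 < pdim ns N)%N, kraus_channel (T N),
      norm12 (T N) = \prod_(i < N) norm12 (Phis i) &
      Smin2 (T N) = \sum_(i < N) Smin2 (Phis i)].
Proof.
elim: N => [|N IH] h.
  have c1 : kraus_channel (T 0) by split => //; exact: (kraus_id R 1).
  split => //; first by rewrite big_ord0 norm12_id1.
  by rewrite (Smin2_norm12 _ c1) //= norm12_id1 big_ord0 expr1n ln1 oppr0.
have [|pN cN eN sN] := IH; first by move=> i iN; apply: h; exact: ltnW.
have [[n0 k0] hP [cpP tP] uP aP] := h N (ltnSn N).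
have cP : kraus_channel (Phis N) by split => //; exact: cp_kraus.
have e : norm12 (tens_map (T N) (Phis N)) = norm12 (T N) * norm12 (Phis N).
  (* The [Cadd] map is the last factor and is first moved to the left. *)
  by rewrite norm12_swap norm12_tens //; [rewrite mulrC | exact: cN.1].
split.
- by rewrite /= muln_gt0 pN n0.
- exact: (kraus_channel_tens cN cP).
- by rewrite big_ord_recr /= -eN e.
- by rewrite big_ord_recr /= -sN (Smin2_tens pN n0 cN cP e).
Qed.

End Family.
End Channels.

Theorem theorem13 (R : realType) :
  (* (1) *)
  (forall (n k m l : nat)
          (Phi : {linear 'M[R[i]]_n -> 'M[R[i]]_k})
          (Omega : {linear 'M[R[i]]_m -> 'M[R[i]]_l}),
      (0 < n)%N -> (0 < k)%N -> (0 < m)%N -> (0 < l)%N ->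
      herm_preserving Phi -> unital Phi -> trace_preserving Phi -> Cadd Phi ->
      herm_preserving Omega -> completely_positive Omega ->
      norm12 (tens_map Phi Omega) = norm12 Phi * norm12 Omega /\
      (quantum_channel Phi -> quantum_channel Omega ->
         Smin2 (tens_map Phi Omega) = Smin2 Phi + Smin2 Omega))
  /\
  (* (2) *)
  (forall (N : nat) (ns ks : nat -> nat)
          (Phis : forall i : nat, {linear 'M[R[i]]_(ns i) -> 'M[R[i]]_(ks i)}),
      (forall i, (i < N)%N ->
         [/\ (0 < ns i)%N /\ (0 < ks i)%N, herm_preserving (Phis i),
             quantum_channel (Phis i), unital (Phis i) & Cadd (Phis i)]) ->
      norm12 (tens_fam (fun i => Phis i) N) = \prod_(i < N) norm12 (Phis i) /\
      Smin2 (tens_fam (fun i => Phis i) N) = \sum_(i < N) Smin2 (Phis i)).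
Proof.
split=> [n k m l Phi Omega n0 k0 m0 _ hP uP tP aP _ /cp_kraus kO|N ns ks Phis h].
  have e := norm12_tens n0 k0 hP uP tP aP kO; split=> // -[cP _] [_ tO].
  by apply: Smin2_tens => //; split=> //; exact: cp_kraus.
by have [_ _] := tens_fam_multiplicative h.
Qed.
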